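(* Let $P_1,P_2$ be oriented paths with $P_1<P_2$ in the homomorphism order. If $h(P_2)\ge 4$, then the interval $[P_1,P_2]$ in the homomorphism order of oriented paths is universal. If $h(P_2)\le 3$, then the interval $[P_1,P_2]$ in the homomorphism order of oriented paths is a chain (any two of its elements are comparable).
   Context: All digraphs are finite. A homomorphism $f:G_1\to G_2$ between digraphs is a map $V(G_1)\to V(G_2)$ sending arcs to arcs; write $G_1\le G_2$ if one exists, and $G_1<G_2$ if $G_1\le G_2$ and $G_2\not\le G_1$. Identifying homomorphically equivalent digraphs makes $\le$ a partial order (the homomorphism order); restricting to a class (e.g. oriented paths) gives the homomorphism order of that class. An oriented path is a digraph whose vertices can be listed $p_0,\dots,p_n$ so that its arcs are exactly one arc between $p_{i-1}$ and $p_i$ (in either direction) for each $1\le i\le n$. $\vec P_k$ denotes the directed path with vertices $0,1,\dots,k$ and arcs $01,12,\dots,(k-1)k$. The height $h(P)$ of an oriented path $P$ is the minimum $k\ge0$ with $P\to\vec P_k$. For $P_1<P_2$, the interval $[P_1,P_2]$ in the homomorphism order of oriented paths is the set of (homomorphic equivalence classes of) oriented paths $P$ with $P_1\le P\le P_2$. A partial order is universal if it contains every countable partial order as a suborder. *)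

(* Defs.v *)
From mathcomp Require Import all_boot.
Set Implicit Arguments. Unset Strict Implicit. Unset Printing Implicit Defensive.

(* An oriented path p_0,...,p_n (up to isomorphism) is encoded by a sequence
   s : seq bool of length n : vertices are 0..n, and for i < n the unique arc
   between i and i+1 is i -> i+1 if nth false s i = true, and i+1 -> i otherwise. *)
Definition opath := seq bool.

Definition vertex (s : opath) (v : nat) : Prop := v <= size s.

Definition arc (s : opath) (u v : nat) : Prop :=
  (v = u.+1 /\ u < size s /\ nth false s u = true) \/
  (u = v.+1 /\ v < size s /\ nth false s v = false).

Definition hom (s t : opath) : Prop :=
  exists f : nat -> nat,
    (forall v, vertex s v -> vertex t (f v)) /\
    (forall u v, arc s u v -> arc t (f u) (f v)).

Definition hom_lt (s t : opath) : Prop := hom s t /\ ~ hom t s.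

Definition dirpath (k : nat) : opath := nseq k true.

Definition is_height (s : opath) (k : nat) : Prop :=
  hom s (dirpath k) /\ forall j, hom s (dirpath j) -> k <= j.

Definition in_interval (p1 p2 p : opath) : Prop := hom p1 p /\ hom p p2.

Definition interval_chain (p1 p2 : opath) : Prop :=
  forall p q, in_interval p1 p2 p -> in_interval p1 p2 q -> hom p q \/ hom q p.

Definition partial_order (T : Type) (le : T -> T -> Prop) : Prop :=
  (forall x, le x x) /\
  (forall x y, le x y -> le y x -> x = y) /\
  (forall x y z, le x y -> le y z -> le x z).

Definition countable (T : Type) : Prop := exists g : T -> nat, injective g.

(* The interval [P1,P2] (a poset of homomorphic-equivalence classes) is universal:
   every countable partial order embeds into it as a suborder, i.e. there is a map
   to paths in the interval that preserves and reflects the order (such a map is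
   automatically injective on equivalence classes, by antisymmetry). *)
Definition interval_universal (p1 p2 : opath) : Prop :=
  forall (T : Type) (le : T -> T -> Prop),
    countable T -> partial_order le ->
    exists f : T -> opath,
      (forall x, in_interval p1 p2 (f x)) /\
      (forall x y, le x y <-> hom (f x) (f y)).

(* Main.v *)
(* Height at least 4.  Replace P2 by its core P, of length n, whose only endomorphism is the
   identity.  Height 4 yields two maximal alternating segments of P, with straight ends, at two
   different inner levels; take each as long as possible for its level.  Lengthening them by 2c
   and 2d gives paths ("letters") P_{c,d} whose homomorphisms to P all go from one end of P to the
   other, and P_{c,d} <= P_{c',d'} along P iff c >= c' and d >= d'.  Concatenating letters forwards
   and backwards alternately gives words, and a homomorphism of words is a walk on letters.  An
   initial path R above P1, but not above P, is attached once to each word.  A long alternation of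
   P_{c,0} and P_{0,d} cannot fold, since two such letters on the same segment would give a copy
   of P; hence it cannot be mapped into R and serves as a marker that aligns the codes of elements
   of the countable order.

   Height at most 3.  A path of height exactly 3 is equivalent to a zigzag whose length is the least
   distance between a vertex of level 0 and a vertex of level 3, and these zigzags form a chain. *)
Require Import Defs.
From Stdlib Require Import Classical ClassicalEpsilon.
From mathcomp Require Import all_boot zify.
Set Implicit Arguments. Unset Strict Implicit. Unset Printing Implicit Defensive.

(** * Walks *)

(** One lengthened segment would give only a chain of letters; the second one makes letters
    incomparable. A word can mention only finitely many elements, so the order is carried over to a
    relation [r] on the natural numbers, and the word of [n] contains the codes of the [k <= n] with
    [r k n]. When [r m n], a code of index at most [n] in the word of [m] occurs in the word of [n]
    too, whereas a code of larger index [k] is sent to the code of [n]. Hence a code must show which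
    smaller indices lie above its own: for [n <= k] the code of [k] can be read along that of [n]
    only if its bit for [n] says [r k n]. It cannot be read along the code of a larger index, since
    it reaches its top letter while the other still shows bits. So a homomorphism from the path of
    [m] to that of [n] reads the code of [m] along the code of some [k] with [r m k] and [r k n].
    The obstacle is the initial path: [P] does not map to it but single lengthened letters may, so
    the place of one letter proves nothing; only [la] and [lb] together force the code out of it. *)

Fixpoint reads (A S : Type) (st : A -> S -> S -> Prop) (s : seq A) (x y : S) : Prop :=
  if s is a :: s' then exists2 z, st a x z & reads st s' z y else x = y.

Lemma reads_cat (A S : Type) (st : A -> S -> S -> Prop) s1 s2 x z :
  reads st (s1 ++ s2) x z <-> exists2 y, reads st s1 x y & reads st s2 y z.
Proof.
elim: s1 x => [|a s1 IH] x /=.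
  by split=> [h|[y -> //]]; exists x.
split.
  by case=> u hu /IH [y h1 h2]; exists y => //; exists u.
by case=> y [u hu h1] h2; exists u => //; apply/IH; exists y.
Qed.

Lemma reads_fun (A : Type) (a0 : A) (S : Type) (st : A -> S -> S -> Prop) s x y :
  reads st s x y <-> exists f : nat -> S, [/\ f 0 = x, f (size s) = y &
    forall i, i < size s -> st (nth a0 s i) (f i) (f i.+1)].
Proof.
elim: s x => [|a s IH] x /=.
  by split=> [->|[f [<- <- _]]] //; exists (fun _ => y).
split.
  case=> z hz /IH [f [f0 fs hf]].
  exists (fun i => if i is j.+1 then f j else x); split=> //.
  by case=> [|i] hi /=; [rewrite f0 | apply: hf].
case=> f [f0 fs hf]; exists (f 1); first by rewrite -f0; apply: (hf 0).
by apply/IH; exists (fun i => f i.+1); split=> // i hi; apply: (hf i.+1).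
Qed.

Lemma reads_sub (A S S' : Type) (st : A -> S -> S -> Prop) (st' : A -> S' -> S' -> Prop)
    (e : S -> S') s x y :
  (forall a u v, st a u v -> st' a (e u) (e v)) -> reads st s x y -> reads st' s (e x) (e y).
Proof.
move=> he; elim: s x => [|a s IH] x /=; first by move=> ->.
by case=> z /he hz /IH h; exists (e z).
Qed.

(** The bit gives the direction of the arc, not that of the move along the listing, so both moves
    may be possible at a vertex. *)
Definition step (t : opath) (b : bool) (x z : nat) : Prop :=
  (z = x.+1 /\ x < size t /\ nth false t x = b) \/
  (x = z.+1 /\ z < size t /\ nth false t z = ~~ b).

Definition rd (t : opath) := reads (step t).

Definition walk (t s : opath) (f : nat -> nat) : Prop :=
  forall i, i < size s -> step t (nth false s i) (f i) (f i.+1).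

Lemma rd_walk t s x y :
  rd t s x y <-> exists2 f, walk t s f & f 0 = x /\ f (size s) = y.
Proof.
rewrite /rd (reads_fun false); split=> [[f [*]]|[f ? [*]]]; by exists f.
Qed.

Lemma rd_cons t b s x y :
  rd t (b :: s) x y <-> exists2 z, step t b x z & rd t s z y.
Proof. by []. Qed.

Lemma step_arc t b x z : step t b x z <-> if b then Defs.arc t x z else Defs.arc t z x.
Proof.
rewrite /step /Defs.arc; case: b => /=; first by [].
by split=> -[[?[? ->]]|[?[? ->]]]; [right|left|right|left].
Qed.

Lemma step_bound t b x z : step t b x z -> x <= size t /\ z <= size t.
Proof. by case=> -[? [? ?]]; lia. Qed.

Lemma step_sym t b x z : step t b x z -> step t (~~ b) z x.
Proof. by case=> -[? [? e]]; [right|left]; rewrite ?negbK. Qed.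

Lemma rd_bound t s x y : x <= size t -> rd t s x y -> y <= size t.
Proof.
elim: s x => [|b s IH] x /= hx; first by move=> <-.
by case=> z /step_bound [_ hz]; apply: IH.
Qed.

(** For the empty path [rd] only says [x = y], so the start is separately required to be a
    vertex. *)
Lemma homP s t : hom s t <-> exists x y, x <= size t /\ rd t s x y.
Proof.
split.
  case=> f [fv fa]; exists (f 0), (f (size s)); split; first by apply: fv.
  apply/rd_walk; exists f => // i hi; apply/step_arc.
  by case e: (nth _ _ _); apply: fa; [left|right].
case=> x [y [hx /rd_walk [f hf [f0 _]]]]; exists f; split.
  move=> [|v] hv; first by rewrite f0.
  by case: (step_bound (hf v hv)).
move=> u v [|] [-> [h e]]; have /step_arc := hf _ h; by rewrite e.
Qed.

Lemma walk_comp u t s f g : walk t s f -> walk u t g -> walk u s (g \o f).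
Proof.
move=> hf hg i hi /=; case: (hf i hi) => -[e [hx e']].
  by rewrite e -e'; apply: hg.
by rewrite e -[X in step _ X]negbK -e'; apply: step_sym; apply: hg.
Qed.

Lemma hom_trans s t u : hom s t -> hom t u -> hom s u.
Proof.
move=> [f [fv fa]] [g [gv ga]]; exists (g \o f); split=> [v /fv /gv //|x y /fa /ga //].
Qed.

Lemma rd_cat t s1 s2 x z :
  rd t (s1 ++ s2) x z <-> exists2 y, rd t s1 x y & rd t s2 y z.
Proof. exact: reads_cat. Qed.

Lemma rd_cat2 t s1 s2 x y z : rd t s1 x y -> rd t s2 y z -> rd t (s1 ++ s2) x z.
Proof. by move=> h1 h2; apply/rd_cat; exists y. Qed.

Lemma walk_infix t s1 s2 s3 f :
  walk t (s1 ++ s2 ++ s3) f -> walk t s2 (fun i => f (size s1 + i)).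
Proof.
move=> hf i hi; have := hf (size s1 + i).
rewrite !size_cat nth_cat ifF ?addKn ?nth_cat ?hi ?addnS; last by lia.
by apply; lia.
Qed.

Lemma walk_self t : walk t t id.
Proof. by move=> i hi; left. Qed.

Lemma rd_self t : rd t t 0 (size t).
Proof. by apply/rd_walk; exists id => //; apply: walk_self. Qed.

Lemma step_embed l t r b x z : step t b x z -> step (l ++ t ++ r) b (size l + x) (size l + z).
Proof.
rewrite /step !size_cat; case=> -[-> [h <-]]; [left|right]; rewrite addnS; split=> //;
  (split; first lia);
  by rewrite nth_cat ifF ?addKn ?nth_cat ?h //; lia.
Qed.

Lemma rd_embed l t r s x y : rd t s x y -> rd (l ++ t ++ r) s (size l + x) (size l + y).
Proof. by apply: reads_sub => a u v; apply: step_embed. Qed.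

Lemma step_restrict l t r b x z : size l <= x <= size l + size t -> size l <= z <= size l + size t ->
  step (l ++ t ++ r) b x z -> step t b (x - size l) (z - size l).
Proof.
move=> hx hz [|] [e [h e2]]; [left|right]; move: e2; rewrite nth_cat nth_cat.
  rewrite ifF; last by lia.
  by rewrite ifT; [lia|lia].
rewrite ifF; last by lia.
by rewrite ifT; [lia|lia].
Qed.

Lemma walk_restrict l t r s f :
  walk (l ++ t ++ r) s f -> (forall i, i <= size s -> size l <= f i <= size l + size t) ->
  rd t s (f 0 - size l) (f (size s) - size l).
Proof.
move=> hf hb; apply/rd_walk; exists (fun i => f i - size l) => // i hi.
by apply: (@step_restrict l t r); [apply: hb; lia|apply: hb; lia|apply: hf].
Qed.

(** The same path listed from its other end. *)
Definition rp (s : opath) : opath := rev (map negb s).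

Lemma size_rp s : size (rp s) = size s.
Proof. by rewrite size_rev size_map. Qed.

Lemma rpK : involutive rp.
Proof.
by move=> s; rewrite /rp map_rev revK -map_comp map_id_in // => b _ /=; rewrite negbK.
Qed.

Lemma nth_rp s i : i < size s -> nth false (rp s) i = ~~ nth false s (size s - i.+1).
Proof.
move=> hi; rewrite nth_rev ?size_map //; rewrite (nth_map false) //; lia.
Qed.

Lemma rd_rp t s x y : rd t s x y -> rd t (rp s) y x.
Proof.
elim: s x => [|b s IH] x /=; first by move=> ->.
case=> z hz /IH h; rewrite /rp /= rev_cons -cats1; apply: rd_cat2 h _.
by exists x => //; apply: step_sym.
Qed.

Lemma step_rpt t b x z : step t b x z -> step (rp t) b (size t - x) (size t - z).
Proof.
rewrite /step size_rp => -[[-> [h <-]]|[-> [h e]]]; [right|left].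
  rewrite nth_rp; last by lia.
  by split; [lia|split; [lia|]]; do 2 f_equal; lia.
rewrite nth_rp; last by lia.
split; [lia|split; [lia|]]; apply: negb_inj; rewrite negbK -e; f_equal; lia.
Qed.

Lemma rd_rpt t s x y : rd t s x y -> rd (rp t) s (size t - x) (size t - y).
Proof. by apply: (@reads_sub _ _ _ _ _ (fun x => size t - x)) => a u v; apply: step_rpt. Qed.

Definition unit_steps (n : nat) (f : nat -> nat) : Prop :=
  forall i, i < n -> f i.+1 = (f i).+1 \/ f i = (f i.+1).+1.

Lemma walk_unit t s f : walk t s f -> unit_steps (size s) f.
Proof. by move=> hf i /hf [[]|[]]; auto. Qed.

Lemma unit_lip n f i j : unit_steps n f -> i <= j -> j <= n ->
  f j <= f i + (j - i) /\ f i <= f j + (j - i) /\ odd (f j + f i + (j - i)) = false.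
Proof.
move=> hf; elim: j => [|j IH] hij hj.
  have -> : i = 0 by lia.
  lia.
have [e|hi] : i = j.+1 \/ i <= j by lia.
  subst i; lia.
have := IH hi (ltnW hj); have := hf j hj; lia.
Qed.

Lemma unit_ivt n f i j r : unit_steps n f -> i <= j -> j <= n ->
  (f i <= r <= f j) \/ (f j <= r <= f i) -> exists2 k, i <= k <= j & f k = r.
Proof.
move=> hf; elim: j => [|j IH] hij hj hr.
  have e : i = 0 by lia.
  by subst i; exists 0; lia.
have [e|hi] : i = j.+1 \/ i <= j by lia.
  subst i; exists j.+1; lia.
have [e|hne] := eqVneq (f j.+1) r; first by exists j.+1; lia.
have [k hk <-] : exists2 k, i <= k <= j & f k = r.
  by apply: IH => //; [lia|have := hf j hj; lia].
by exists k => //; lia.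
Qed.

(** * Cores *)

(** Recording the ends is enough: [size P] unit steps from 0 to [size P] leave room only for the
    identity. *)
Definition rigid (P : opath) : Prop :=
  forall x y, x <= size P -> rd P P x y -> x = 0 /\ y = size P.

Lemma hom_infix l t r : hom t (l ++ t ++ r).
Proof.
apply/homP; exists (size l), (size l + size t); split; first by rewrite !size_cat; lia.
by have := rd_embed l r (rd_self t); rewrite addn0.
Qed.

Lemma hom_in_range t s f m M : walk t s f -> m <= M <= size t ->
  (forall i, i <= size s -> m <= f i <= M) -> hom s (drop m (take M t)).
Proof.
move=> hf hm hb.
have et : t = take m t ++ drop m (take M t) ++ drop M t.
  by rewrite catA -{1}(take_takel t (proj1 (andP hm))) cat_take_drop cat_take_drop.
have sm : size (take m t) = m by rewrite size_take; case: ifP; lia.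
have sM : size (drop m (take M t)) = M - m by rewrite size_drop size_take; case: ifP; lia.
rewrite et in hf; have := walk_restrict hf.
rewrite sm sM => h; apply/homP; exists (f 0 - m), (f (size s) - m); split.
  by rewrite sM; have := hb 0 isT; lia.
by apply: h => i /hb; lia.
Qed.

(* A hom from a shortest path to itself is onto, hence the identity or the reversal; the latter
   would fold the path in half. *)
Lemma rigid_of_minimal P :
  (forall s, size s < size P -> hom P s -> hom s P -> False) -> rigid P.
Proof.
move=> hmin x y hx /rd_walk [f hf [f0 fn]]; subst x y.
set n := size P in hmin hx *.
(* A map of [P] into the segment from [m] to [M] makes the two equivalent, so by minimality the
   segment is all of [P]. *)
have full g m M : walk P P g -> m <= M <= n -> (forall i, i <= n -> m <= g i <= M) -> M - m = n.
  move=> hg hm hb; apply/eqP; rewrite eqn_leq; apply/andP; split; first by lia.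
  rewrite leqNgt; apply/negP => hlt.
  apply: (hmin (drop m (take M P))); first by rewrite size_drop size_take -/n; case: ifP; lia.
    exact: hom_in_range hg hm hb.
  have := hom_infix (take m P) (drop m (take M P)) (drop M P).
  by rewrite catA -{1}(take_takel P (proj1 (andP hm))) cat_take_drop cat_take_drop.
have fb i : i <= n -> f i <= n.
  by case: i => [//|i] hi; case: (step_bound (hf i hi)).
have [n0|npos] : n = 0 \/ 0 < n by lia.
  by split; [move: hx | have := fb n]; lia.
have hit v : v = 0 \/ v = n -> exists2 i, i <= n & f i = v.
  move=> hv; apply: NNPP => hno.
  have hne i : i <= n -> f i <> v by move=> hi e; apply: hno; exists i.
  case: hv => e.
    by have := @full f 1 n hf; rewrite npos leqnn => /(_ isT) h;
      suff : n - 1 = n by [lia]; apply: h => i hi; have := hne i hi; have := fb i hi; lia.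
  have h := @full f 0 n.-1 hf.
  suff : n.-1 - 0 = n by lia.
  by apply: h => [|i hi]; [lia|have := hne i hi; have := fb i hi; lia].
have [i0 hi0 e0] := hit 0 (or_introl erefl).
have [j0 hj0 ej] := hit n (or_intror erefl).
have uf := walk_unit hf.
have [hij|hij] := leqP i0 j0.
  have [h _] := unit_lip uf hij hj0.
  have a0 : i0 = 0 by lia.
  have b0 : j0 = n by lia.
  by subst i0 j0; rewrite e0 ej.
exfalso.
have [_ [h _]] := unit_lip uf (ltnW hij) hi0.
have a0 : i0 = n by lia.
have b0 : j0 = 0 by lia.
subst i0 j0.
have fE i : i <= n -> f i = n - i.
  move=> hi; have [h1 [h2 _]] := unit_lip uf (leq0n i) hi.
  by have [h3 [h4 _]] := unit_lip uf hi (leqnn _); rewrite -/n in h3 h4; lia.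
have flip i : i < n -> nth false P (n - i.+1) = ~~ nth false P i.
  by move=> hi; have := hf i hi; rewrite /step !fE; [case=> -[h1 [h2 h3]]; [lia|]|lia|lia].
have := flip n./2.
(* For odd [n] the reversal would turn the middle arc around. For even [n] it fixes the middle
   vertex, and gluing it there to the identity maps [P] onto its first half. *)
have [on|en] := boolP (odd n).
  have -> : n - n./2.+1 = n./2 by lia.
  by move/(_ ltac:(lia)); case: (nth _ _ _).
move=> _.
pose g i := if i <= n./2 then i else n - i.
suff : n./2 - 0 = n by lia.
apply: (@full g 0 n./2); [|lia|rewrite /g => i; case: ifP; lia].
move=> i hi; rewrite -/n in hi; rewrite /step /g.
have [h1|h1] := ltnP i n./2.
  by left; rewrite (ltnW h1); split=> //; split=> //; lia.
right; split=> /=; first by case: ifP; lia.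
split; [lia|exact: flip].
Qed.

Lemma core_exists t : exists P, [/\ hom P t, hom t P & rigid P].
Proof.
have [m] := ubnP (size t); elim: m t => // m IH t hm.
have [[s [hs h1 h2]]|hno] := classic (exists s, [/\ size s < size t, hom t s & hom s t]).
  have [|P [h3 h4 h5]] := IH s; first by lia.
  by exists P; split=> //; [apply: hom_trans h3 h2|apply: hom_trans h1 h4].
exists t; split; [by exists id|by exists id|].
by apply: rigid_of_minimal => s hs h1 h2; apply: hno; exists s.
Qed.

(** * Alternating walks and straight vertices *)

Definition straight (P : opath) (p : nat) : bool :=
  [&& 0 < p, p < size P & nth false P p.-1 == nth false P p].

(** At a turning vertex the two arcs both enter or both leave, so a walk has to change its bit
    there. *)
Lemma straight_pass P b p q r : step P b q p -> step P b p r -> straight P p.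
Proof.
rewrite /straight; case=> -[e [h1 h2]] [] [e' [h3 h4]].
- by subst p; rewrite h3 /= h2 h4 eqxx.
- have ? : r = q by [lia]; subst r; by move: h4; rewrite h2; case: (b).
- by move: h4; rewrite h2; case: (b).
- by subst p; rewrite h1 /= h2 h4 eqxx.
Qed.

Definition alternating (s : opath) : Prop :=
  forall i, i.+1 < size s -> nth false s i.+1 = ~~ nth false s i.

Definition alt (b : bool) (n : nat) : opath := mkseq (fun i => b (+) odd i) n.

Lemma size_alt b n : size (alt b n) = n. Proof. exact: size_mkseq. Qed.

Lemma nth_alt b n i : i < n -> nth false (alt b n) i = b (+) odd i.
Proof. exact: nth_mkseq. Qed.

Lemma alternating_alt b n : alternating (alt b n).
Proof.
by move=> i; rewrite size_alt => hi; rewrite !nth_alt ?(ltnW hi) //= addbN.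
Qed.

Lemma alt_S b n : alt b n.+1 = b :: alt (~~ b) n.
Proof.
apply: (@eq_from_nth _ false); first by rewrite [RHS]/= !size_alt.
rewrite size_alt => -[|i] hi; rewrite nth_alt //= ?addbF // nth_alt //.
by case: b; case: (odd i).
Qed.

(** A walk that comes to [z] from below must repeat its bit to go on, which an alternating word
    never does. From a start at [z] itself the first step would be free, hence the strict
    inequality. *)
Lemma alt_walk_le P s f z : walk P s f -> alternating s -> straight P z -> f 0 < z ->
  forall i, i <= size s -> f i <= z.
Proof.
move=> hf ha /and3P [z0 zn /eqP zs] h0.
have H i : i <= size s -> f i < z \/ f i = z /\ exists j, i = j.+1 /\ f j = z.-1.
  elim: i => [|i IH] hi; first by left.
  have {IH}[hlt|[e [j [ej fj]]]] := IH (ltnW hi).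
    have [?|h] : f i.+1 < z \/ f i.+1 = z by case: (hf i hi); lia.
      by left.
    by right; split=> //; exists i; split=> //; case: (hf i hi); lia.
  left; subst i; have := hf j (ltnW hi); have := hf _ hi; rewrite ha //= /step e fj.
  case=> -[e1 [h1 h2]]; last by lia.
  by case=> -[e3 [h3 h4]]; [move: h2; rewrite -h4 -zs; case: (nth _ _ _)|lia].
by move=> i /H; lia.
Qed.

Lemma straight_rp P z : straight P z -> straight (rp P) (size P - z).
Proof.
case/and3P=> z0 zn /eqP zs; rewrite /straight size_rp; apply/and3P; split; [lia|lia|].
rewrite !nth_rp; [|lia|lia].
have -> : size P - (size P - z).-1.+1 = z by lia.
have -> : size P - (size P - z).+1 = z.-1 by lia.
by rewrite zs.
Qed.

Lemma alt_walk_ge P s f z : walk P s f -> alternating s -> straight P z -> z < f 0 ->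
  forall i, i <= size s -> z <= f i.
Proof.
move=> hf ha hz h0 i hi.
have [s0|spos] : size s = 0 \/ 0 < size s by lia.
  have -> : i = 0 by lia.
  exact: ltnW.
have fb j : j <= size s -> f j <= size P.
  case: j => [_|j hj]; last by case: (step_bound (hf j hj)).
  by case: (step_bound (hf 0 spos)).
have h := @alt_walk_le (rp P) s (fun i => size P - f i) (size P - z) _ ha (straight_rp hz).
have : size P - f i <= size P - z.
  apply: h => //; last by have := fb 0; lia.
  by move=> j hj; apply: step_rpt; apply: hf.
by have := fb i hi; have := fb 0; case/and3P: hz; lia.
Qed.

Lemma walk_shift P s f k : walk P s f -> walk P (drop k s) (fun i => f (k + i)).
Proof.
move=> hf i; rewrite size_drop => hi; rewrite nth_drop addnS; apply: hf; lia.
Qed.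

Lemma alt_widen P b L p q : 0 < L -> rd P (alt b L) p q -> rd P (alt b L.+2) p q.
Proof.
case: L => // L _ h; rewrite (alt_S b L.+2) (alt_S _ L.+1) negbK.
move: (h); rewrite alt_S => -[z hz _].
by exists z => //; exists p; [apply: step_sym|rewrite -alt_S].
Qed.

Lemma rd_lip P s x y : rd P s x y ->
  y <= x + size s /\ x <= y + size s /\ odd (y + x + size s) = false.
Proof.
case/rd_walk=> f hf [<- <-].
by have := unit_lip (walk_unit hf) (leq0n _) (leqnn _); rewrite subn0.
Qed.

(** Either the first step leaves a distance small enough for induction, or it moves away from [q]
    and the second step has to undo it; these two steps can then be deleted. *)
Lemma alt_shorten P b L p q : rd P (alt b L.+2) p q -> q <= p + L -> p <= q + L ->
  rd P (alt b L) p q.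
Proof.
elim: L b p => [|L IH] b p h h1 h2; first by rewrite (_ : p = q) //; lia.
move: (h); rewrite alt_S => /rd_cons [z hz hr].
have := rd_lip hr; rewrite size_alt => -[h3 [h4 h5]].
have hz' : z = p.+1 \/ p = z.+1 by case: hz; lia.
have [[h6 h7]|far] : (q <= z + L /\ z <= q + L) \/ ~ (q <= z + L /\ z <= q + L) by apply: classic.
  by rewrite alt_S; exists z => //; apply: IH.
move: hr; rewrite alt_S => /rd_cons [w hw hr].
have := rd_lip hr; rewrite size_alt => -[h8 [h9 h10]].
have hw' : w = z.+1 \/ z = w.+1 by case: hw; lia.
have ew : w = p by lia.
by move: hr; rewrite negbK ew.
Qed.

(** Only parity and distance restrict the length of an alternating walk. This exchanges lengthened
    and original runs without moving the ends of the walk. *)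
Lemma alt_resize P b L a p q : rd P (alt b L) p q -> 0 < L -> odd (L + a) = false ->
  q <= p + a -> p <= q + a -> rd P (alt b a) p q.
Proof.
move=> h L0 hp h1 h2.
have [hle|hlt] := leqP L a.
  have [k ->] : exists k, a = L + 2 * k by exists (a - L)./2; lia.
  elim: k => [|k IH]; first by rewrite addn0.
  have -> : L + 2 * k.+1 = (L + 2 * k).+2 by lia.
  by apply: alt_widen => //; lia.
have [k ek] : exists k, L = a + 2 * k by exists (L - a)./2; lia.
subst L; elim: k h {L0 hp hlt} => [|k IH]; first by rewrite addn0.
have -> : a + 2 * k.+1 = (a + 2 * k).+2 by lia.
by move=> h; apply: IH; apply: alt_shorten h _ _; lia.
Qed.

(** * Runs and letters *)

(** Since the length is odd, the path enters the run from the level just outside it on one side and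
    leaves to the level just outside it on the other side, instead of turning back. *)
Definition run (P : opath) (x y : nat) : Prop :=
  [/\ x < y, odd (y - x), straight P x, straight P y &
      forall r, x < r < y -> ~~ straight P r].

(* Boolean hypotheses make [lia] split cases exponentially, hence the clearing. *)
Ltac nlia := repeat match goal with
  | H : context [nth] |- _ => clear H
  | H : context [straight] |- _ => clear H
  | H : walk _ _ _ |- _ => clear H
  | H : rd _ _ _ _ |- _ => clear H
  | H : run _ _ _ |- _ => clear H
  end; lia.

Ltac split_ifs := repeat (case: ifP => ?; try (exfalso; nlia)).

Lemma run_bound P x y : run P x y -> [/\ 0 < x, x < y & y < size P].
Proof. by case=> h _ /and3P [] ? _ _ /and3P [] _ ? _ _. Qed.

Lemma run_nth P x y i : run P x y -> x <= i < y ->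
  nth false P i = nth false P x (+) odd (i - x).
Proof.
move=> hr; have [x0 xy yn] := run_bound hr; case: hr => _ _ _ _ hns.
elim: i => [|i IH] hi; first by lia.
have [e|hlt] : i.+1 = x \/ x <= i by lia.
  by rewrite e subnn addbF.
have : ~~ straight P i.+1 by apply: hns; lia.
rewrite /straight /= IH; last by lia.
have -> : i.+1 - x = (i - x).+1 by lia.
rewrite (_ : i.+1 < size P) /=; last by lia.
by case: (nth false P i.+1); case: (nth false P x); case: (odd _).
Qed.

(* [P] with its runs [x1, y1] and [x2, y2] lengthened by [2 * l.1] and [2 * l.2]. *)
Definition letter (P : opath) (x1 y1 x2 y2 : nat) (l : nat * nat) : opath :=
  take x1 P ++ alt (nth false P x1) (y1 - x1 + 2 * l.1) ++ drop y1 (take x2 P) ++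
  alt (nth false P x2) (y2 - x2 + 2 * l.2) ++ drop y2 P.

Section LetterBits.
Variables (P : opath) (x1 y1 x2 y2 : nat).
Hypotheses (run1 : run P x1 y1) (run2 : run P x2 y2) (h12 : y1 <= x2).
Variables c d : nat.
Let s := letter P x1 y1 x2 y2 (c, d).

Let b1 : 0 < x1. Proof. by case: (run_bound run1). Qed.
Let b2 : x1 < y1. Proof. by case: (run_bound run1). Qed.
Let b3 : x2 < y2. Proof. by case: (run_bound run2). Qed.
Let b4 : y2 < size P. Proof. by case: (run_bound run2). Qed.

Lemma size_letter : size s = size P + 2 * c + 2 * d.
Proof.
rewrite /s /letter !size_cat !size_alt !size_drop !size_take /=.
by do 2 (case: ifP; last lia); lia.
Qed.

Lemma nth_letterE i : nth false s i =
  if i < x1 then nth false P i else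
  if i < y1 + 2 * c then nth false P x1 (+) odd (i - x1) else
  if i < x2 + 2 * c then nth false P (i - 2 * c) else
  if i < y2 + 2 * c + 2 * d then nth false P x2 (+) odd (i - (x2 + 2 * c)) else
  nth false P (i - 2 * c - 2 * d).
Proof.
rewrite /s /letter /=.
have e1 : size (take x1 P) = x1 by rewrite size_take; case: ifP; lia.
have e2 : size (drop y1 (take x2 P)) = x2 - y1.
  by rewrite size_drop size_take; case: ifP; lia.
rewrite !nth_cat !size_alt e1 e2; case: ifP => h1; first by rewrite nth_take.
have -> : (i - x1 < y1 - x1 + 2 * c) = (i < y1 + 2 * c) by lia.
case: ifP => h2; first by rewrite nth_alt //; lia.
have -> : (i - x1 - (y1 - x1 + 2 * c) < x2 - y1) = (i < x2 + 2 * c) by lia.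
case: ifP => h3.
  by rewrite nth_drop nth_take; [f_equal; lia|lia].
have -> : (i - x1 - (y1 - x1 + 2 * c) - (x2 - y1) < y2 - x2 + 2 * d) =
  (i < y2 + 2 * c + 2 * d) by lia.
case: ifP => h4; first by rewrite nth_alt; [do 2 f_equal; lia|lia].
by rewrite nth_drop; f_equal; lia.
Qed.

Lemma straight_nth p : straight P p -> nth false P p.-1 = nth false P p.
Proof. by case/and3P=> _ _ /eqP. Qed.

Let o1 : odd (y1 - x1). Proof. by case: run1. Qed.
Let o2 : odd (y2 - x2). Proof. by case: run2. Qed.

Lemma nth_letter1 i : i <= x1 -> nth false s i = nth false P i.
Proof.
rewrite nth_letterE => hi; split_ifs => //.
have -> : i = x1 by lia.
by rewrite subnn addbF.
Qed.

Lemma nth_letter2 i : x1 <= i < y1 + 2 * c ->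
  nth false s i = nth false P x1 (+) odd (i - x1).
Proof. by rewrite nth_letterE => hi; split_ifs. Qed.

Lemma nth_letter3 i : y1 + 2 * c <= i <= x2 + 2 * c ->
  nth false s i = nth false P (i - 2 * c).
Proof.
rewrite nth_letterE => hi; split_ifs => //.
have -> : i = x2 + 2 * c by lia.
by rewrite subnn addbF addnK.
Qed.

Lemma nth_letter4 i : x2 + 2 * c <= i < y2 + 2 * c + 2 * d ->
  nth false s i = nth false P x2 (+) odd (i - (x2 + 2 * c)).
Proof. by rewrite nth_letterE => hi; split_ifs. Qed.

Lemma nth_letter5 i : y2 + 2 * c + 2 * d <= i ->
  nth false s i = nth false P (i - 2 * c - 2 * d).
Proof. by rewrite nth_letterE => hi; split_ifs. Qed.

(* The hom to [P] folding the extra arcs of a run onto its first arc. *)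
Definition fold_map (i : nat) : nat :=
  if i <= x1 then i else
  if i <= x1 + 2 * c then x1 + odd (i - x1) else
  if i <= x2 + 2 * c then i - 2 * c else
  if i <= x2 + 2 * c + 2 * d then x2 + odd (i - (x2 + 2 * c)) else
  i - 2 * c - 2 * d.

Lemma fold_map_walk : walk P s fold_map.
Proof.
move=> i; rewrite size_letter => hi.
have fwd j : nth false s i = nth false P j -> j < size P -> step P (nth false s i) j j.+1.
  by move=> -> hj; left.
have bwd j : nth false s i = ~~ nth false P j -> j < size P -> step P (nth false s i) j.+1 j.
  by move=> -> hj; right; rewrite negbK.
have [h1|h1] := ltnP i x1.
  rewrite /fold_map h1 (ltnW h1); apply: fwd; [apply: nth_letter1; exact: ltnW|lia].
have [h2|h2] := ltnP i (x1 + 2 * c).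
  have -> : fold_map i = x1 + odd (i - x1).
    by rewrite /fold_map; split_ifs; lia.
  have -> : fold_map i.+1 = x1 + odd (i.+1 - x1).
    by rewrite /fold_map; split_ifs; lia.
  have hb : nth false s i = nth false P x1 (+) odd (i - x1) by apply: nth_letter2; lia.
  have -> : i.+1 - x1 = (i - x1).+1 by lia.
  rewrite /=; case: (odd _) hb => /= hb; rewrite ?addn0 ?addn1.
    by apply: bwd; [rewrite hb addbT|lia].
  by apply: fwd; [rewrite hb addbF|lia].
have [h3|h3] := ltnP i (x2 + 2 * c).
  have -> : fold_map i = i - 2 * c.
    by rewrite /fold_map; split_ifs; lia.
  have -> : fold_map i.+1 = (i - 2 * c).+1.
    by rewrite /fold_map; split_ifs; lia.
  apply: fwd; last by lia.
  have [h4|h4] := ltnP i (y1 + 2 * c); last by apply: nth_letter3; lia.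
  rewrite nth_letter2; last by lia.
  by rewrite (@run_nth _ _ _ (i - 2 * c) run1); [congr (_ (+) _); lia|lia].
have [h4|h4] := ltnP i (x2 + 2 * c + 2 * d).
  have -> : fold_map i = x2 + odd (i - (x2 + 2 * c)).
    by rewrite /fold_map; split_ifs; lia.
  have -> : fold_map i.+1 = x2 + odd (i.+1 - (x2 + 2 * c)).
    by rewrite /fold_map; split_ifs; lia.
  have hb : nth false s i = nth false P x2 (+) odd (i - (x2 + 2 * c)) by apply: nth_letter4; lia.
  have -> : i.+1 - (x2 + 2 * c) = (i - (x2 + 2 * c)).+1 by lia.
  rewrite /=; case: (odd _) hb => /= hb; rewrite ?addn0 ?addn1.
    by apply: bwd; [rewrite hb addbT|lia].
  by apply: fwd; [rewrite hb addbF|lia].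
have -> : fold_map i = i - 2 * c - 2 * d.
  by rewrite /fold_map; split_ifs; lia.
have -> : fold_map i.+1 = (i - 2 * c - 2 * d).+1.
  by rewrite /fold_map; split_ifs; lia.
apply: fwd; last by lia.
have [h5|h5] := ltnP i (y2 + 2 * c + 2 * d); last by apply: nth_letter5; lia.
rewrite nth_letter4; last by lia.
by rewrite (@run_nth _ _ _ (i - 2 * c - 2 * d) run2); [congr (_ (+) _); lia|lia].
Qed.

Lemma letter_cuts : [/\ fold_map 0 = 0, fold_map x1 = x1, fold_map (y1 + 2 * c) = y1,
  fold_map (x2 + 2 * c) = x2 & fold_map (y2 + 2 * c + 2 * d) = y2 /\ fold_map (size s) = size P].
Proof.
by split; [| | | |split]; rewrite ?size_letter /fold_map; split_ifs; try lia.
Qed.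

End LetterBits.

(** In a directed path the bit decides the direction of the move, so two walks reading the same word
    stay at constant distance. *)
Lemma level_shift h s G1 G2 : walk (dirpath h) s G1 -> walk (dirpath h) s G2 ->
  forall i, i <= size s -> G1 i + G2 0 = G2 i + G1 0.
Proof.
move=> h1 h2; elim=> [|i IH] hi; first by lia.
have := IH (ltnW hi); have := h1 _ hi; have := h2 _ hi; rewrite /step size_nseq.
by case: (nth _ s i) => -[] [? [? +]] [] [? [? +]]; rewrite !nth_nseq; (do 2 (case: ifP => //)); lia.
Qed.

Lemma run_straight P x y : run P x y -> straight P x /\ straight P y.
Proof. by case. Qed.

Lemma zone_walk P s f a b b0 : walk P s f -> b <= size s ->
  (forall i, a <= i < b -> nth false s i = b0 (+) odd (i - a)) ->
  walk P (alt b0 (b - a)) (fun i => f (a + i)).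
Proof.
move=> hf hb hz i; rewrite size_alt => hi; rewrite nth_alt //.
have := hf (a + i); rewrite hz ?addKn ?addnS; last by nlia.
by apply; nlia.
Qed.

(** The repeated bits at both borders of the zone force straight vertices of [P], and a straight
    vertex strictly between them would have stopped the alternating walk. *)
Lemma zone_run P s f a b b0 : walk P s f -> 0 < a < b -> b < size s -> odd (b - a) ->
  nth false s a.-1 = b0 -> nth false s b = b0 ->
  (forall i, a <= i < b -> nth false s i = b0 (+) odd (i - a)) ->
  [/\ straight P (f a), straight P (f b) & run P (minn (f a) (f b)) (maxn (f a) (f b))].
Proof.
move=> hf hab hbs hodd ha hb hz.
have ea : nth false s a = b0 by rewrite hz ?subnn ?addbF //; nlia.
have eb : nth false s b.-1 = b0.
  rewrite hz; last by nlia.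
  by have -> : odd (b.-1 - a) = false by [nlia]; rewrite addbF.
have sa : straight P (f a).
  have := hf a.-1; rewrite ha prednK; last by nlia.
  move=> /(_ ltac:(nlia)) h1.
  have := hf a; rewrite ea => /(_ ltac:(nlia)); exact: straight_pass h1.
have sb : straight P (f b).
  have := hf b.-1; rewrite eb prednK; last by nlia.
  move=> /(_ ltac:(nlia)) h1.
  have := hf b; rewrite hb => /(_ ltac:(nlia)); exact: straight_pass h1.
have hw := zone_walk hf (ltnW hbs) hz.
have [h1 [h2 h3]] := unit_lip (walk_unit hf) (ltnW (proj2 (andP hab))) (ltnW hbs).
have hlast : f (a + (b - a)) = f b by f_equal; nlia.
split=> //; split.
- nlia.
- nlia.
- by case: leqP.
- by case: leqP.
- move=> r hr; apply/negP => sr.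
  have [h|h] := leqP (f a) (f b).
    have := alt_walk_le hw (@alternating_alt _ _) sr; rewrite addn0 => /(_ ltac:(nlia)).
    by move=> /(_ (b - a)); rewrite size_alt leqnn hlast => /(_ isT); nlia.
  have := alt_walk_ge hw (@alternating_alt _ _) sr; rewrite addn0 => /(_ ltac:(nlia)).
  by move=> /(_ (b - a)); rewrite size_alt leqnn hlast => /(_ isT); nlia.
Qed.

(** The first step can only go up to [x + 1]; from there neither straight end can be passed. The
    lower bound is applied from [a + 1] on, because the barrier needs a start off the straight
    vertex. *)
Lemma zone_confined P s f a b x y : walk P s f -> b <= size s -> run P x y -> f a = x ->
  (forall i, a <= i < b -> nth false s i = nth false P x (+) odd (i - a)) ->
  forall i, a <= i <= b -> x <= f i <= y.
Proof.
move=> hf hb hr fa hz i hi.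
have [x0 xy yn] := run_bound hr; have [sx sy] := run_straight hr.
have [e|hlt] : i = a \/ a < i by nlia.
  by rewrite e fa; nlia.
have h1 : f a.+1 = x.+1.
  have := hf a; rewrite hz ?subnn ?addbF; last by nlia.
  move=> /(_ ltac:(nlia)); rewrite fa /step; case=> [[]//|[e [h]]].
  by have := straight_nth sx; rewrite {1}e /= => ->; case: (nth _ _ _).
have w1 := zone_walk hf hb hz.
have w2 : walk P (alt (~~ nth false P x) (b - a.+1)) (fun j => f (a.+1 + j)).
  apply: (zone_walk hf) => // j hj; rewrite hz; last by nlia.
  have -> : j - a = (j - a.+1).+1 by nlia.
  by case: (nth _ _ _) => /=; case: (odd _).
apply/andP; split.
  have := alt_walk_ge w2 (@alternating_alt _ _) sx; rewrite addn0 h1 => /(_ ltac:(nlia)).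
  by move=> /(_ (i - a.+1)); rewrite size_alt; have -> : a.+1 + (i - a.+1) = i by [nlia]; apply; nlia.
have := alt_walk_le w1 (@alternating_alt _ _) sy; rewrite addn0 fa => /(_ ltac:(nlia)).
by move=> /(_ (i - a)); rewrite size_alt; have -> : a + (i - a) = i by [nlia]; apply; nlia.
Qed.

Lemma walk_slice P s f t a b : walk P s f -> a + size t = b -> b <= size s ->
  (forall i, i < size t -> nth false t i = nth false s (a + i)) -> rd P t (f a) (f b).
Proof.
move=> hf <- hs ht; apply/rd_walk; exists (fun i => f (a + i)); last by rewrite addn0.
move=> i hi; rewrite ht // addnS; apply: hf; nlia.
Qed.

Lemma letter00 P x1 y1 x2 y2 : run P x1 y1 -> run P x2 y2 -> y1 <= x2 ->
  letter P x1 y1 x2 y2 (0, 0) = P.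
Proof.
move=> r1 r2 h; apply: (@eq_from_nth _ false); rewrite size_letter //; first by nlia.
move=> i hi; rewrite nth_letterE //.
split_ifs => //.
- by rewrite (@run_nth _ _ _ i r1) //; nlia.
- by f_equal; nlia.
- rewrite (@run_nth _ _ _ i r2) //; last by nlia.
  by congr (_ (+) odd _); nlia.
- by f_equal; nlia.
Qed.

(* By maximality a run of [P] traversed by a lengthened run can also be traversed at the original
   length, so every hom from a letter to [P] induces an endomorphism of [P], the identity. *)
Section LetterRigid.
Variables (P : opath) (x1 y1 x2 y2 h : nat) (G : nat -> nat).
Hypotheses (run1 : run P x1 y1) (run2 : run P x2 y2) (h12 : y1 <= x2).
Hypotheses (hG : walk (dirpath h) P G) (hG0 : exists2 i, i <= size P & G i = 0)
  (hGh : exists2 i, i <= size P & G i = h) (hGb : forall i, i <= size P -> G i <= h).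
Hypothesis max1 : forall x y, run P x y ->
  minn (G x) (G y) = minn (G x1) (G y1) -> y - x <= y1 - x1.
Hypothesis max2 : forall x y, run P x y ->
  minn (G x) (G y) = minn (G x2) (G y2) -> y - x <= y2 - x2.
Hypothesis hrig : rigid P.

Lemma letter_rigid c d g : walk P (letter P x1 y1 x2 y2 (c, d)) g ->
  let len := size P + 2 * c + 2 * d in
  [/\ g 0 = 0, g len = size P, forall i, 0 < i < len -> 0 < g i < size P,
      g (y1 + 2 * c).-1 = y1.-1 /\ g (y1 + 2 * c).+1 = y1.+1 &
      (forall i, i <= y1 + 2 * c -> g i <= y1) /\
      (forall i, y1 + 2 * c <= i <= len -> y1 <= g i)].
Proof.
move=> hg len; set s := letter P x1 y1 x2 y2 (c, d) in hg.
have [x10 xy1 _] := run_bound run1; have [_ xy2 y2n] := run_bound run2.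
have ss : size s = len by apply: size_letter.
have [/straight_nth st1 /straight_nth st2] := run_straight run1.
have [/straight_nth st3 /straight_nth st4] := run_straight run2.
have o1 : odd (y1 - x1) by case: run1.
have o2 : odd (y2 - x2) by case: run2.
have e1 : nth false P y1.-1 = nth false P x1.
  by rewrite (run_nth run1); [have -> : odd (y1.-1 - x1) = false; [nlia|rewrite addbF]|nlia].
have e2 : nth false P y2.-1 = nth false P x2.
  by rewrite (run_nth run2); [have -> : odd (y2.-1 - x2) = false; [nlia|rewrite addbF]|nlia].
have z1 i : x1 <= i < y1 + 2 * c -> nth false s i = nth false P x1 (+) odd (i - x1).
  by apply: nth_letter2.
have z2 i : x2 + 2 * c <= i < y2 + 2 * c + 2 * d ->
    nth false s i = nth false P x2 (+) odd (i - (x2 + 2 * c)).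
  by apply: nth_letter4.
have [sx1 sy1 r1] : [/\ straight P (g x1), straight P (g (y1 + 2 * c)) &
    run P (minn (g x1) (g (y1 + 2 * c))) (maxn (g x1) (g (y1 + 2 * c)))].
  apply: (@zone_run P s g x1 (y1 + 2 * c) (nth false P x1)) => //; try nlia.
    by rewrite nth_letter1 //; nlia.
  rewrite nth_letter3 //; last by nlia.
  by rewrite addnK -st2.
have [sx2 sy2 r2] : [/\ straight P (g (x2 + 2 * c)), straight P (g (y2 + 2 * c + 2 * d)) &
    run P (minn (g (x2 + 2 * c)) (g (y2 + 2 * c + 2 * d)))
          (maxn (g (x2 + 2 * c)) (g (y2 + 2 * c + 2 * d)))].
  apply: (@zone_run P s g (x2 + 2 * c) (y2 + 2 * c + 2 * d) (nth false P x2)) => //; try nlia.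
    have [e|hlt] : x2 = y1 \/ y1 < x2 by nlia.
      rewrite z1; last by nlia.
      have -> : odd ((x2 + 2 * c).-1 - x1) = false by nlia.
      by rewrite addbF -e1 e -st2.
    rewrite nth_letter3 //; last by nlia.
    by rewrite -st3; f_equal; nlia.
  rewrite (nth_letter5 run1 run2 h12); last by nlia.
  by rewrite -e2 st4; f_equal; nlia.
(* The folding map serves as the reference with which the arbitrary walk [g] is compared. *)
have [V [hV v0 v1 v2 [v3 v4 v5]]] : exists V, [/\ walk P s V, V 0 = 0, V x1 = x1,
   V (y1 + 2 * c) = y1 & [/\ V (x2 + 2 * c) = x2, V (y2 + 2 * c + 2 * d) = y2 & V len = size P]].
  exists (fold_map x1 x2 c d); have [? ? ? ? [? e]] := letter_cuts run1 run2 h12 c d.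
  split=> //; first exact: fold_map_walk.
  by split=> //; rewrite -ss.
(* The levels along [g] and [V] differ by a constant. It is 0, because [V] passes over all of [P]
   and so already meets the levels 0 and [h]. *)
have lev i : i <= len -> G (g i) = G (V i).
  rewrite -ss => hi.
  have sh := level_shift (walk_comp hg hG) (walk_comp hV hG).
  have back r : r <= size P -> exists2 k, k <= size s & V k = r.
    move=> hr; have [|k hk e] := @unit_ivt _ V 0 (size s) r (walk_unit hV) (leq0n _) (leqnn _).
      by left; rewrite v0 ss v5 leq0n.
    by exists k => //; case/andP: hk.
  have gb k : k <= size s -> g k <= size P.
    case: k => [|k] hk; last by case: (step_bound (hg k hk)).
    by case: (step_bound (hg 0 _)) => //; rewrite ss /len; nlia.
  have [i0 /back [k0 hk0 e0] e0'] := hG0.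
  have [i1 /back [k1 hk1 e1'] e1''] := hGh.
  have := sh _ hk0; have := sh _ hk1; have := sh _ hi; rewrite /= e0 e1' e0' e1''.
  by have := hGb (gb _ hk1); have := hGb (gb _ hk0); nlia.

have lx1 : G (g x1) = G x1 by rewrite lev ?v1 //; nlia.
have ly1 : G (g (y1 + 2 * c)) = G y1 by rewrite lev ?v2 //; nlia.
have lx2 : G (g (x2 + 2 * c)) = G x2 by rewrite lev ?v3 //; nlia.
have ly2 : G (g (y2 + 2 * c + 2 * d)) = G y2 by rewrite lev ?v4 //; nlia.
(* The image of a lengthened run is a run at the level of the original one, so maximality bounds its
   length. *)
have d1 : maxn (g x1) (g (y1 + 2 * c)) - minn (g x1) (g (y1 + 2 * c)) <= y1 - x1.
  by apply: (max1 r1); case: (leqP (g x1)) => _; rewrite lx1 ly1 // minnC.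
have d2 : maxn (g (x2 + 2 * c)) (g (y2 + 2 * c + 2 * d)) -
    minn (g (x2 + 2 * c)) (g (y2 + 2 * c + 2 * d)) <= y2 - x2.
  by apply: (max2 r2); case: (leqP (g (x2 + 2 * c))) => _; rewrite lx2 ly2 // minnC.
have lp : [/\ size (take x1 P) = x1, size (drop y1 (take x2 P)) = x2 - y1 & size (drop y2 P) = size P - y2].
  by rewrite !size_drop !size_take; split; split_ifs; nlia.
case: lp => l1 l3 l5.
have q1 : rd P (take x1 P) (g 0) (g x1).
  apply: (walk_slice hg); rewrite ?l1; try nlia.
  by move=> i hi; rewrite nth_take // add0n nth_letter1 //; nlia.
have q2 : rd P (alt (nth false P x1) (y1 - x1)) (g x1) (g (y1 + 2 * c)).
  apply: (@alt_resize _ _ (y1 + 2 * c - x1)); try nlia.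
  apply: (walk_slice hg); rewrite ?size_alt; try nlia.
  by move=> i hi; rewrite z1 ?nth_alt ?addKn //; nlia.
have q3 : rd P (drop y1 (take x2 P)) (g (y1 + 2 * c)) (g (x2 + 2 * c)).
  apply: (walk_slice hg); rewrite ?l3; try nlia.
  move=> i hi; rewrite nth_drop nth_take; last by nlia.
  by rewrite nth_letter3 //; [f_equal|]; nlia.
have q4 : rd P (alt (nth false P x2) (y2 - x2)) (g (x2 + 2 * c)) (g (y2 + 2 * c + 2 * d)).
  apply: (@alt_resize _ _ (y2 + 2 * d - x2)); try nlia.
  apply: (walk_slice hg); rewrite ?size_alt; try nlia.
  by move=> i hi; rewrite z2 ?nth_alt ?addKn //; nlia.
have q5 : rd P (drop y2 P) (g (y2 + 2 * c + 2 * d)) (g len).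
  apply: (walk_slice hg); rewrite ?l5; try nlia.
  by move=> i hi; rewrite nth_drop nth_letter5 //; [f_equal|]; nlia.
have hb0 : g 0 <= size P.
  by case: (step_bound (hg 0 _)) => //; rewrite ss /len; nlia.
(* With both runs brought back to their original length, the five pieces form an endomorphism of
   [P]. *)
have [g0 gn] : g 0 = 0 /\ g len = size P.
  apply: (hrig hb0); rewrite -{2}(letter00 run1 run2 h12) /letter /= !muln0 !addn0.
  exact: rd_cat2 q1 (rd_cat2 q2 (rd_cat2 q3 (rd_cat2 q4 q5))).
(* The pieces can move by at most their lengths, and these add up to [size P]; so each of them is
   fully used. *)
have [c1 c2 c3 c4] : [/\ g x1 = x1, g (y1 + 2 * c) = y1, g (x2 + 2 * c) = x2 &
    g (y2 + 2 * c + 2 * d) = y2].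
  move: (rd_lip q1) (rd_lip q2) (rd_lip q3) (rd_lip q4) (rd_lip q5).
  rewrite !size_alt l1 l3 l5 g0 gn => -[a1 _] [a2 _] [a3 _] [a4 _] [a5 _].
  by split; nlia.
have ug := walk_unit hg; rewrite ss in ug.
clear V hV v0 v1 v2 v3 v4 v5 q1 q2 q3 q4 q5 lx1 ly1 lx2 ly2 d1 d2 l1 l3 l5 lev o1 o2 r1 r2
  sx1 sy1 sx2 sy2 st1 st2 st3 st4 e1 e2 hG hG0 hGh hGb max1 max2 hb0.
have f1 i : i <= x1 -> g i = i.
  move=> hi; have [? _] := @unit_lip _ _ 0 i ug isT ltac:(nlia).
  by have [? _] := @unit_lip _ _ i x1 ug hi ltac:(nlia); nlia.
have f2 : forall i, x1 <= i <= y1 + 2 * c -> x1 <= g i <= y1.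
  by apply: (zone_confined hg) => //; nlia.
have f3 i : y1 + 2 * c <= i <= x2 + 2 * c -> g i = i - 2 * c.
  move=> hi; have [? _] := @unit_lip _ _ (y1 + 2 * c) i ug ltac:(nlia) ltac:(nlia).
  by have [? _] := @unit_lip _ _ i (x2 + 2 * c) ug ltac:(nlia) ltac:(nlia); nlia.
have f4 : forall i, x2 + 2 * c <= i <= y2 + 2 * c + 2 * d -> x2 <= g i <= y2.
  by apply: (zone_confined hg) => //; nlia.
have f5 i : y2 + 2 * c + 2 * d <= i <= len -> g i = i - 2 * c - 2 * d.
  move=> hi; have [? _] := @unit_lip _ _ (y2 + 2 * c + 2 * d) i ug ltac:(nlia) ltac:(nlia).
  by have [? _] := @unit_lip _ _ i len ug ltac:(nlia) ltac:(nlia); nlia.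
have cas i : i <= len -> i <= x1 \/ x1 <= i <= y1 + 2 * c \/ y1 + 2 * c <= i <= x2 + 2 * c \/
    x2 + 2 * c <= i <= y2 + 2 * c + 2 * d \/ y2 + 2 * c + 2 * d <= i <= len.
  by nlia.
split=> //.
- move=> i hi; case: (cas i) => [|hc|[hc|[hc|[hc|hc]]]]; first by nlia.
  + by rewrite f1 //; nlia.
  + by have := f2 _ hc; nlia.
  + by rewrite f3 //; nlia.
  + by have := f4 _ hc; nlia.
  + by rewrite f5 //; nlia.
- split.
    have := f2 (y1 + 2 * c).-1; have := ug (y1 + 2 * c).-1.
    by rewrite prednK; nlia.
  have [e|hlt] : x2 = y1 \/ y1 < x2 by nlia.
    by have := f4 (y1 + 2 * c).+1; have := ug (y1 + 2 * c); rewrite /len; nlia.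
  by rewrite f3; nlia.
- have at_z i : i = y1 + 2 * c -> g i = y1 by move=> ->.
  split=> i hi.
    have [e|hlt] : i = y1 + 2 * c \/ i < y1 + 2 * c by nlia.
      by rewrite (at_z i e).
    have [h1|h1] := leqP i x1; first by rewrite f1 //; nlia.
    by have := f2 i; nlia.
  have [e|hlt] : i = y1 + 2 * c \/ y1 + 2 * c < i by nlia.
    by rewrite (at_z i e).
  case: (cas i) => [|hc|[hc|[hc|[hc|hc]]]]; [nlia|nlia|nlia| | |].
  + by rewrite f3 //; nlia.
  + by have := f4 _ hc; nlia.
  + by rewrite f5 //; nlia.
Qed.
End LetterRigid.

(* [z] lies between the two lengthened runs, and a hom from a letter to [P] crosses it only once. *)
Record alphabet (P : opath) (z : nat) (Y : nat * nat -> opath) : Prop := Alphabet {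
  al_size : forall l, size (Y l) = size P + 2 * l.1 + 2 * l.2;
  al_zero : Y (0, 0) = P;
  al_z : 0 < z < size P;
  al_rigid : forall l g, walk P (Y l) g ->
    [/\ g 0 = 0, g (size (Y l)) = size P,
      forall i, 0 < i < size (Y l) -> 0 < g i < size P,
      g (z + 2 * l.1).-1 = z.-1 /\ g (z + 2 * l.1).+1 = z.+1 &
      (forall i, i <= z + 2 * l.1 -> g i <= z) /\
      (forall i, z + 2 * l.1 <= i <= size (Y l) -> z <= g i)];
  al_le : forall l l', l'.1 <= l.1 -> l'.2 <= l.2 -> rd (Y l') (Y l) 0 (size (Y l'));
  al_take : forall d, take z.+1 (Y (0, d)) = take z.+1 P;
  al_drop : forall c, drop (z.+1 + 2 * c) (Y (c, 0)) = drop z.+1 P }.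

Lemma rd_embed_mid l t r s : rd t s 0 (size t) -> rd (l ++ t ++ r) s (size l) (size (l ++ t)).
Proof. by move=> /(@rd_embed l _ r); rewrite addn0 size_cat. Qed.

(** The common parts are copied and each alternating part is resized, which allows any length of the
    same parity. *)
Lemma rd_letter_le P x1 y1 x2 y2 l l' : run P x1 y1 -> run P x2 y2 -> y1 <= x2 ->
  l'.1 <= l.1 -> l'.2 <= l.2 ->
  rd (letter P x1 y1 x2 y2 l') (letter P x1 y1 x2 y2 l) 0 (size (letter P x1 y1 x2 y2 l')).
Proof.
move=> r1 r2 h h1 h2.
have a b m k k' : 0 < m -> k' <= k -> rd (alt b (m + 2 * k')) (alt b (m + 2 * k)) 0
    (size (alt b (m + 2 * k'))).
  move=> hm hk; apply: (@alt_resize _ _ (m + 2 * k')); rewrite ?size_alt; try nlia.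
  by have := rd_self (alt b (m + 2 * k')); rewrite size_alt.
rewrite /letter; set A := take x1 P; set B := drop y1 _; set C := drop y2 P.
set E1 := alt _ (_ + 2 * l'.1); set E2 := alt _ (_ + 2 * l'.2).
apply: (@rd_cat2 _ _ _ _ (size A)).
  by have := @rd_embed [::] A (E1 ++ B ++ E2 ++ C) A _ _ (rd_self A).
apply: (@rd_cat2 _ _ _ _ (size (A ++ E1))).
  by apply: rd_embed_mid; apply: a => //; have := run_bound r1; case; nlia.
apply: (@rd_cat2 _ _ _ _ (size ((A ++ E1) ++ B))).
  by have := @rd_embed_mid (A ++ E1) B (E2 ++ C) _ (rd_self B); rewrite -!catA.
apply: (@rd_cat2 _ _ _ _ (size (((A ++ E1) ++ B) ++ E2))).
  have := @rd_embed_mid ((A ++ E1) ++ B) E2 C; rewrite -!catA; apply.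
  by apply: a => //; have := run_bound r2; case; nlia.
have := @rd_embed_mid (((A ++ E1) ++ B) ++ E2) C [::] _ (rd_self C).
by rewrite -!catA cats0.
Qed.

Lemma alphabet_of_runs P x1 y1 x2 y2 h G : run P x1 y1 -> run P x2 y2 -> y1 <= x2 ->
  walk (dirpath h) P G -> (exists2 i, i <= size P & G i = 0) ->
  (exists2 i, i <= size P & G i = h) -> (forall i, i <= size P -> G i <= h) ->
  (forall x y, run P x y -> minn (G x) (G y) = minn (G x1) (G y1) -> y - x <= y1 - x1) ->
  (forall x y, run P x y -> minn (G x) (G y) = minn (G x2) (G y2) -> y - x <= y2 - x2) ->
  rigid P -> alphabet P y1 (letter P x1 y1 x2 y2).
Proof.
move=> r1 r2 h12 hG hG0 hGh hGb m1 m2 hr.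
have [x0 xy1 _] := run_bound r1; have [_ xy2 y2n] := run_bound r2.
have [_ s1] := run_straight r1; have [s2 _] := run_straight r2.
split.
- by case=> c d; apply: size_letter.
- exact: letter00.
- lia.
- case=> c d g /(letter_rigid r1 r2 h12 hG hG0 hGh hGb m1 m2 hr).
  by rewrite -(size_letter r1 r2 h12).
- by move=> l l'; apply: rd_letter_le.
- move=> d; rewrite -{2}(letter00 r1 r2 h12).
  apply: (@eq_from_nth _ false); rewrite !size_take !size_letter //.
    by split_ifs; nlia.
  move=> i hi; have {}hi : i < y1.+1 by move: hi; split_ifs; nlia.
  rewrite !nth_take // !nth_letterE //; split_ifs => //.
- move=> c; rewrite -{2}(letter00 r1 r2 h12).
  apply: (@eq_from_nth _ false); rewrite !size_drop !size_letter //; first by nlia.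
  move=> i hi; rewrite !nth_drop.
  have [hh|hh] := leqP (y1.+1 + i) x2.
    by rewrite !nth_letter3 //; try nlia; f_equal; nlia.
  have [hh'|hh'] := leqP y2 (y1.+1 + i).
    by rewrite !nth_letter5 //; try nlia; f_equal; nlia.
  by rewrite !nth_letter4 //; try nlia; congr (_ (+) odd _); nlia.
Qed.

(** * Longest runs at the inner levels *)

Lemma nat_min (Q : nat -> Prop) : (exists n, Q n) ->
  exists2 n, Q n & forall m, Q m -> n <= m.
Proof.
case=> n; have [k] := ubnP n; elim: k n => // k IH n hn hQ.
have [[m [hm Qm]]|hno] := classic (exists m, m < n /\ Q m).
  by apply: IH Qm; lia.
by exists n => // m Qm; rewrite leqNgt; apply/negP => hlt; apply: hno; exists m.
Qed.

Definition dist (i j : nat) : nat := i - j + (j - i).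

(** A vertex in between at level at most [a] or at least [b] would, by the intermediate value
    property, give a closer pair. The lemma yields the runs here and the zigzags of height 3. *)
Lemma closest_pair n G a b : unit_steps n G -> a < b ->
  (exists2 i, i <= n & G i = a) -> (exists2 i, i <= n & G i = b) ->
  exists p q, [/\ p < q <= n, (G p = a /\ G q = b) \/ (G p = b /\ G q = a),
    forall r, p < r < q -> a < G r < b &
    forall i j, i <= n -> j <= n -> G i = a -> G j = b -> q - p <= dist i j].
Proof.
move=> hG hab [i0 hi0 ei0] [j0 hj0 ej0].
have [d [i [j [hi hj ei ej ed]]] dmin] : exists2 d, (exists i j, [/\ i <= n, j <= n, G i = a, G j = b
    & dist i j = d]) & forall m, (exists i j, [/\ i <= n, j <= n, G i = a, G j = b
    & dist i j = m]) -> d <= m.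
  by apply: nat_min; exists (dist i0 j0), i0, j0.
have {}dmin i' j' : i' <= n -> j' <= n -> G i' = a -> G j' = b -> d <= dist i' j'.
  by move=> *; apply: dmin; exists i', j'.
have inner r : minn i j < r < maxn i j -> a < G r < b.
  move=> hr; rewrite ltnNge [X in _ && X]ltnNge -negb_or; apply/negP => /orP [h|h].
    have [hij|hij] := leqP i j.
      have [k hk ek] := @unit_ivt n G r j a hG ltac:(lia) ltac:(lia) ltac:(lia).
      have kj : k <> j by [move=> e; subst k; lia].
  by have := dmin k j ltac:(lia) hj ek ej; rewrite /dist in ed *; lia.
    have [k hk ek] := @unit_ivt n G j r a hG ltac:(lia) ltac:(lia) ltac:(lia).
    have kj : k <> j by [move=> e; subst k; lia].
  by have := dmin k j ltac:(lia) hj ek ej; rewrite /dist in ed *; lia.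
  have [hij|hij] := leqP i j.
    have [k hk ek] := @unit_ivt n G i r b hG ltac:(lia) ltac:(lia) ltac:(lia).
    have ki : k <> i by [move=> e; subst k; lia].
  by have := dmin i k hi ltac:(lia) ei ek; rewrite /dist in ed *; lia.
  have [k hk ek] := @unit_ivt n G r i b hG ltac:(lia) ltac:(lia) ltac:(lia).
  have ki : k <> i by [move=> e; subst k; lia].
  by have := dmin i k hi ltac:(lia) ei ek; rewrite /dist in ed *; lia.
have hne : i <> j by move=> e; subst j; lia.
exists (minn i j), (maxn i j); split.
- lia.
- by case: (leqP i j) => _; [left|right].
- exact: inner.
- by move=> *; apply: leq_trans (dmin _ _ _ _ _ _) => //; rewrite /dist in ed; lia.
Qed.

Lemma level_nth h P G i : walk (dirpath h) P G -> i < size P ->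
  nth false P i = (G i < G i.+1).
Proof.
move=> hG hi; case: (hG i hi); rewrite size_nseq => -[e [h1]]; rewrite nth_nseq h1 e.
  by move=> <-; rewrite ltnSn.
by case: (nth false P i) => // _; lia.
Qed.

(** Between a closest pair of vertices at levels [l - 1] and [l + 2] only the levels [l] and [l + 1]
    occur, so the path alternates there; removing the first and last arc leaves the run. *)
Lemma run_exists h P G l : walk (dirpath h) P G -> (exists2 i, i <= size P & G i = 0) ->
  (exists2 i, i <= size P & G i = h) -> 0 < l -> l.+2 <= h ->
  exists x y, run P x y /\ minn (G x) (G y) = l.
Proof.
move=> hG [i0 hi0 e0] [i1 hi1 e1] l0 lh.
have uG := walk_unit hG.
have att v : v <= h -> exists2 i, i <= size P & G i = v.
  move=> hv; have [hle|hlt] := leqP i0 i1.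
    have [|k hk ek] := unit_ivt uG hle hi1 (r := v); first by rewrite e0 e1; lia.
    by exists k => //; lia.
  have [|k hk ek] := unit_ivt uG (ltnW hlt) hi0 (r := v); first by rewrite e0 e1; lia.
  by exists k => //; lia.
have [|||p [q [hpq hv hin _]]] := @closest_pair _ G l.-1 l.+2 uG; try (by apply: att; lia).
  lia.
have [hpq' hqn] := andP hpq.
have hp1 := uG p ltac:(lia); have hq1 := uG q.-1 ltac:(lia).
rewrite prednK in hq1; last by lia.
have hd : p.+3 <= q.
  by have [h1 [h2 _]] := unit_lip uG (ltnW hpq') hqn; clear -l0 h1 h2 hv; lia.
have vals r : p < r < q -> G r = l \/ G r = l.+1 by move=> /hin; lia.
have e2 : q.-2.+1 = q.-1 by lia.
have e3 : q.-1.+1 = q by lia.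
have K : (G p < G p.+1) = (G p.+1 < G p.+2) /\ (G q.-2 < G q.-1) = (G q.-1 < G q) /\
    odd (G p.+1 + G q.-1) /\ minn (G p.+1) (G q.-1) = l.
  have v1 := vals p.+1 ltac:(lia); have v2 := vals p.+2 ltac:(lia).
  have v3 := vals q.-1 ltac:(lia); have v4 := vals q.-2 ltac:(lia).
  have u1 := uG p.+1 ltac:(lia); have u2 := uG q.-2 ltac:(lia); rewrite e2 in u2.
  clear vals hin hd e2 e3 hpq hpq' hqn att uG hG hi0 hi1 e0 e1 lh.
  case: hv => -[ea eb].
    have w1 : G p.+1 = l by clear -ea v1 hp1 l0; lia.
    have w2 : G p.+2 = l.+1 by clear -w1 v2 u1; lia.
    have w3 : G q.-1 = l.+1 by clear -eb v3 hq1; lia.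
    have w4 : G q.-2 = l by clear -w3 v4 u2; lia.
    by rewrite ea eb w1 w2 w3 w4; clear -l0; repeat split; lia.
  have w1 : G p.+1 = l.+1 by clear -ea v1 hp1 l0; lia.
  have w2 : G p.+2 = l by clear -w1 v2 u1; lia.
  have w3 : G q.-1 = l by clear -eb v3 hq1 l0; lia.
  have w4 : G q.-2 = l.+1 by clear -w3 v4 u2; lia.
  by rewrite ea eb w1 w2 w3 w4; clear -l0; repeat split; lia.
case: K => k1 [k2 [k3 k4]]; exists p.+1, q.-1; split=> //.
clear hv hp1 hq1 hi0 hi1 e0 e1.
split.
- have : p.+1 <> q.-1 by move=> e; rewrite -e in k3; clear -k3; lia.
  clear -hd; lia.
- have [_ [_]] := @unit_lip _ _ p.+1 q.-1 uG ltac:(lia) ltac:(lia).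
  by clear -k3; lia.
- rewrite /straight !(level_nth hG); [|lia|lia]; rewrite prednK // k1 eqxx andbT.
  by clear -hd hqn; lia.
- rewrite /straight !(level_nth hG); [|lia|lia].
  rewrite e2 e3 k2 eqxx andbT; clear -hd hqn; lia.
- move=> r hr; rewrite /straight !(level_nth hG); [|lia|lia]; rewrite prednK; last by lia.
  have w1 := vals r ltac:(lia); have w2 := vals r.-1 ltac:(lia).
  have w3 := vals r.+1 ltac:(lia).
  have w4 := uG r.-1 ltac:(lia); have w5 := uG r ltac:(lia).
  rewrite prednK in w4; last by lia.
  by apply/negP => /and3P [_ _ /eqP]; clear -w1 w2 w3 w4 w5; lia.
Qed.

Lemma longest_run P (Q : nat -> nat -> Prop) :
  (exists x y, run P x y /\ Q x y) -> exists x y, [/\ run P x y, Q x y &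
    forall x' y', run P x' y' -> Q x' y' -> y' - x' <= y - x].
Proof.
case=> x0 [y0 [r0 q0]].
have [d [x [y [hr hq e]]] hmin] :
    exists2 d, (exists x y, [/\ run P x y, Q x y & size P - (y - x) = d]) &
    forall m, (exists x y, [/\ run P x y, Q x y & size P - (y - x) = m]) -> d <= m.
  by apply: nat_min; exists (size P - (y0 - x0)), x0, y0.
exists x, y; split=> // x' y' hr' hq'.
have := hmin _ (ex_intro _ x' (ex_intro _ y' (And3 hr' hq' erefl))).
by have [] := run_bound hr; have [] := run_bound hr'; lia.
Qed.

(** If one of the two extreme levels were missed, the directed path could be cut down, against the
    minimality of [h]. *)
Lemma height_level s h : is_height s h -> exists G, [/\ walk (dirpath h) s G,
  forall i, i <= size s -> G i <= h, exists2 i, i <= size s & G i = 0 &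
  exists2 i, i <= size s & G i = h].
Proof.
case=> /homP [x [y [hx /rd_walk [G hG [G0 Gn]]]]] hmin; exists G.
rewrite size_nseq in hx.
have hb i : i <= size s -> G i <= h.
  case: i => [_|i hi]; first by rewrite G0.
  by case: (step_bound (hG i hi)); rewrite size_nseq.
have sub m M : m <= M <= h -> (forall i, i <= size s -> m <= G i <= M) -> h <= M - m.
  move=> hm hi; apply: hmin.
  have := @hom_in_range (dirpath h) s G m M hG; rewrite size_nseq => /(_ hm hi).
  congr (hom _ _); apply: (@eq_from_nth _ false); rewrite size_drop size_take !size_nseq.
    by split_ifs; lia.
  move=> i; split_ifs => hi'; rewrite nth_drop nth_take ?nth_nseq; by [lia|split_ifs].
have att v : v = 0 \/ v = h -> exists2 i, i <= size s & G i = v.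
  move=> hv; apply: NNPP => hno.
  have hne i : i <= size s -> G i <> v by move=> hi e; apply: hno; exists i.
  have := hne 0 isT; have := hb 0 isT.
  case: hv => e; subst v.
    move=> h1 h2; have := sub 1 h ltac:(lia).
    suff H : h <= h - 1 by lia.
    by apply: sub; [lia|move=> i hi; have := hne i hi; have := hb i hi; lia].
  move=> h1 h2; suff H : h <= h.-1 - 0 by lia.
  by apply: sub; [lia|move=> i hi; have := hne i hi; have := hb i hi; lia].
by split=> //; apply: att; [left|right].
Qed.

(** Runs are available at each level [l] with [0 < l] and [l + 2 <= h]; height 4 is what provides
    two of them, 1 and 2. *)
Lemma alphabet_exists P h : rigid P -> is_height P h -> 4 <= h -> exists z Y, alphabet P z Y.
Proof.
move=> hr /height_level [G [hG hb h0 hh]] h4.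
have [x1 [y1 [r1 l1 m1]]] := longest_run (run_exists hG h0 hh (l := 1) isT ltac:(lia)).
have [x2 [y2 [r2 l2 m2]]] := longest_run (run_exists hG h0 hh (l := 2) isT ltac:(lia)).
(* No end of a run is interior to another run, as ends are straight. Overlapping runs would
   therefore coincide, which their levels exclude. *)
have hdis : y1 <= x2 \/ y2 <= x1.
  have [s1 t1] := run_straight r1; have [s2 t2] := run_straight r2.
  have [_ b1 _] := run_bound r1; have [_ b2 _] := run_bound r2.
  case: (r1) => _ _ _ _ n1; case: (r2) => _ _ _ _ n2.
  have [hlt|hge] := ltnP x2 y1; last by left.
  have [hlt'|hge] := ltnP x1 y2; last by right.
  exfalso; have [hx|hx] := eqVneq x1 x2.
    have [hy|hy] := eqVneq y1 y2; first by subst; lia.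
    have [h1|h1] := ltnP y1 y2.
      by have := n2 y1; rewrite t1 /=; lia.
    by have := n1 y2; rewrite t2 /=; lia.
  have [h1|h1] := ltnP x1 x2.
    by have := n1 x2; rewrite s2 /=; lia.
  by have := n2 x1; rewrite s1 /=; lia.
case: hdis => hd.
  exists y1, (letter P x1 y1 x2 y2).
  by apply: (alphabet_of_runs r1 r2 hd hG h0 hh hb); rewrite ?l1 ?l2.
exists y2, (letter P x2 y2 x1 y1).
by apply: (alphabet_of_runs r2 r1 hd hG h0 hh hb); rewrite ?l1 ?l2.
Qed.

(** * Words of letters *)

(* Longer runs give smaller paths, so the order on pairs is reversed. *)
Definition letter_le (x y : nat * nat) : bool := (y.1 <= x.1) && (y.2 <= x.2).

Lemma walk_rp P s f : walk P s f -> walk P (rp s) (fun i => f (size s - i)).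
Proof.
move=> hf i; rewrite size_rp => hi; rewrite nth_rp //.
have := step_sym (hf (size s - i.+1) ltac:(lia)).
by have -> : (size s - i.+1).+1 = size s - i by lia.
Qed.

Section Words.
Variables (P : opath) (z : nat) (Y : nat * nat -> opath).
Hypothesis hY : alphabet P z Y.

Let zP : 0 < z < size P := al_z hY.

Lemma letter_size_gt1 l : 1 < size (Y l).
Proof. by rewrite (al_size hY); lia. Qed.

Lemma letter_proj l : exists pi, walk P (Y l) pi.
Proof.
have := @al_le _ _ _ hY l (0, 0) isT isT; rewrite (al_zero hY).
by case/rd_walk=> pi h _; exists pi.
Qed.

(** Followed by the projection to [P], the map crosses [z] exactly at the copy of [z] in [Y l]. So
    the part of [Y l] on each side of that copy must be long enough to cover the corresponding part
    of [Y l'], which compares the two parameters one by one. *)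
Lemma letter_letter l l' p q : rd (Y l') (Y l) p q ->
  [/\ p = 0, q = size (Y l') & letter_le l l'].
Proof.
case/rd_walk=> f hf [<- <-].
have [pi hpi] := letter_proj l'.
have [p0 pn pin [_ _] [ple pge]] := al_rigid hY hpi.
have [g0 gn gin [gm gp] _] := al_rigid hY (walk_comp hf hpi).
rewrite /= in g0 gn gin gm gp.
have fb i : i <= size (Y l) -> f i <= size (Y l').
  case: i => [|i] hi; last by case: (step_bound (hf i hi)).
  by case: (step_bound (hf 0 _)) => //; apply: ltnW; apply: letter_size_gt1.
have s1 := letter_size_gt1 l; have s2 := letter_size_gt1 l'.
have f0 : f 0 = 0.
  have := fb 0 isT; have := pin (f 0).
  have [e|ne] := eqVneq (f 0) (size (Y l')); first by move: g0; rewrite e pn; lia.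
  by rewrite g0; lia.
have fn : f (size (Y l)) = size (Y l').
  have := fb _ (leqnn _); have := pin (f (size (Y l))).
  have [e|ne] := eqVneq (f (size (Y l))) 0; first by move: gn; rewrite e p0; lia.
  by rewrite gn; lia.
have uf := walk_unit hf.
have e1 := al_size hY l; have e2 := al_size hY l'.
split=> //; apply/andP; split.
  have h1 : z + 2 * l'.1 < f (z + 2 * l.1).+1.
    by rewrite ltnNge; apply/negP => /ple; rewrite gp ltnn.
  have [h2 _] := @unit_lip _ _ 0 (z + 2 * l.1).+1 uf isT ltac:(lia).
  by rewrite f0 in h2; clear -h1 h2; lia.
have h1 : f (z + 2 * l.1).-1 < z + 2 * l'.1.
  rewrite ltnNge; apply/negP => h; have := pge (f (z + 2 * l.1).-1).
  by rewrite gm h fb //=; lia.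
have [h2 _] := @unit_lip _ _ (z + 2 * l.1).-1 (size (Y l)) uf ltac:(lia) ltac:(lia).
rewrite fn in h2; clear -h1 h2 e1 e2 zP; lia.
Qed.

(** Inner vertices of a letter lie over inner vertices of [P], whereas the cut lies over an end of
    [P]; so the letter cannot pass it. *)
Lemma letter_cut t1 t2 pi l p q : walk P (t1 ++ t2) pi ->
  pi (size t1) = 0 \/ pi (size t1) = size P -> rd (t1 ++ t2) (Y l) p q ->
  [/\ p <= size t1, q <= size t1 & rd t1 (Y l) p q] \/
  [/\ size t1 <= p, size t1 <= q & rd t2 (Y l) (p - size t1) (q - size t1)].
Proof.
move=> hpi hcut /rd_walk [f hf [<- <-]].
have [_ _ gin _ _] := al_rigid hY (walk_comp hf hpi); rewrite /= in gin.
have s1 := letter_size_gt1 l; have uf := walk_unit hf.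
have off i : 0 < i < size (Y l) -> f i <> size t1.
  by move=> /gin h e; move: h; rewrite e; case: hcut => ->; rewrite ?ltnn ?andbF.
have side i j : 0 < i <= j -> j < size (Y l) -> (f i < size t1) = (f j < size t1).
  move=> hij hj; have o1 := off i ltac:(lia); have o2 := off j ltac:(lia).
  apply/idP/idP => h; rewrite ltnNge; apply/negP => h'.
    have [k hk ek] := @unit_ivt _ f i j (size t1) uf ltac:(lia) (ltnW hj) ltac:(lia).
    by apply: (off k) ek; lia.
  have [k hk ek] := @unit_ivt _ f i j (size t1) uf ltac:(lia) (ltnW hj) ltac:(lia).
  by apply: (off k) ek; lia.
have u0 := uf 0 ltac:(lia); have un := uf (size (Y l)).-1 ltac:(lia).
rewrite prednK in un; last by lia.
have fb i : i <= size (Y l) -> f i <= size t1 + size t2.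
  case: i => [|i] hi; last by case: (step_bound (hf i hi)); rewrite size_cat.
  by case: (step_bound (hf 0 ltac:(lia))); rewrite size_cat.
have [h1|h1] := ltnP (f 1) (size t1); [left|right].
  have all i : i <= size (Y l) -> f i <= size t1.
    move=> hi; have [e|[e|hm]] : i = 0 \/ i = size (Y l) \/ 0 < i < size (Y l) by lia.
    - by subst i; lia.
    - by subst i; have := @side 1 (size (Y l)).-1 ltac:(lia) ltac:(lia); rewrite h1; lia.
    - by have := @side 1 i ltac:(lia) ltac:(lia); rewrite h1; lia.
  split; [exact: all|exact: all|].
  have := @walk_restrict [::] t1 t2 (Y l) f hf; rewrite /= !subn0; apply.
  by move=> i hi; rewrite add0n all.
have all i : i <= size (Y l) -> size t1 <= f i.
  have o1 := off 1 ltac:(lia).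
  move=> hi; have [e|[e|hm]] : i = 0 \/ i = size (Y l) \/ 0 < i < size (Y l) by lia.
  - by subst i; lia.
  - by subst i; have o2 := off (size (Y l)).-1 ltac:(lia); have := @side 1 (size (Y l)).-1 ltac:(lia) ltac:(lia); lia.
  - by have := @side 1 i ltac:(lia) ltac:(lia); lia.
split; [exact: all|exact: all|].
have := @walk_restrict t1 t2 [::] (Y l) f; rewrite cats0; apply => //.
by move=> i hi; rewrite all // fb.
Qed.

(* Letters are read alternately forwards and backwards, so that consecutive ones share the vertex
   over an end of [P]; [o] tells whether the first one is reversed. *)
Fixpoint wbits (o : bool) (w : seq (nat * nat)) : opath :=
  if w is x :: w' then (if o then rp (Y x) else Y x) ++ wbits (~~ o) w' else [::].

Definition wpos (w : seq (nat * nat)) (k : nat) : nat := sumn [seq size (Y x) | x <- take k w].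

Lemma wbits_cat o w1 w2 : wbits o (w1 ++ w2) = wbits o w1 ++ wbits (o (+) odd (size w1)) w2.
Proof.
elim: w1 o => [|x w1 IH] o /=; first by rewrite addbF.
by rewrite IH -catA addbN addNb.
Qed.

Lemma size_wbits o w : size (wbits o w) = wpos w (size w).
Proof.
rewrite /wpos take_size; elim: w o => //= x w IH o; rewrite size_cat IH.
by case: o; rewrite ?size_rp.
Qed.

Lemma wpos0 w : wpos w 0 = 0.
Proof. by rewrite /wpos take0. Qed.

Lemma wposS x0 w k : k < size w -> wpos w k.+1 = wpos w k + size (Y (nth x0 w k)).
Proof. by move=> hk; rewrite /wpos (take_nth x0) // map_rcons sumn_rcons. Qed.

Lemma wpos_lt w i j : i < j -> j <= size w -> wpos w i < wpos w j.
Proof.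
elim: j => // j IH hij hj; rewrite (wposS (0, 0)) //.
have := letter_size_gt1 (nth (0, 0) w j).
have [e|h] : i = j \/ i < j by lia.
  by rewrite e; lia.
by have := IH h (ltnW hj); lia.
Qed.

Lemma wpos_inj w i j : i <= size w -> j <= size w -> wpos w i = wpos w j -> i = j.
Proof.
move=> hi hj e; have [h|h|//] := ltngtP i j.
  by have := wpos_lt h hj; lia.
by have := wpos_lt h hi; lia.
Qed.

Lemma letter_in_word w o pi l p q : walk P (wbits o w) pi -> rd (wbits o w) (Y l) p q ->
  exists k, [/\ k < size w, letter_le l (nth (0, 0) w k) &
    if odd k (+) o then p = wpos w k.+1 /\ q = wpos w k
    else p = wpos w k /\ q = wpos w k.+1].
Proof.
elim: w o pi p q => [|x w IH] o pi p q /= hpi hrd.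
  have := letter_size_gt1 l; case: (Y l) hrd => // b s.
  by case/rd_cons=> u [] [_ []].
set t1 := if o then _ else _ in hpi hrd.
have h1 : walk P t1 pi.
  by have := @walk_infix P [::] t1 (wbits (~~ o) w) pi hpi.
have h2 : walk P (wbits (~~ o) w) (fun i => pi (size t1 + i)).
  by have := @walk_shift _ _ _ (size t1) hpi; rewrite drop_size_cat.
have st1 : size t1 = size (Y x) by rewrite /t1; case: (o); rewrite ?size_rp.
have hcut : pi (size t1) = 0 \/ pi (size t1) = size P.
  rewrite st1; move: h1; rewrite /t1; case: (o) => h1.
    have := walk_rp h1; rewrite rpK size_rp => /(al_rigid hY) [+ _ _ _ _].
    by rewrite subn0; left.
  by case: (al_rigid hY h1) => _ -> _ _ _; right.
have [[hp hq h]|[hp hq h]] := letter_cut hpi hcut hrd.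
  exists 0; rewrite wpos0 /wpos /= take0 /= addn0 -st1.
  move: h; rewrite /t1 /=; case: (o) => h.
    have := rd_rpt h; rewrite rpK size_rp => /letter_letter [e1 e2 e3].
    rewrite st1 in hp hq; by split=> //; lia.
  by have [] := letter_letter h.
have [k [hk hl hpos]] := IH _ _ _ _ h2 h.
exists k.+1; split=> //.
have e j : wpos (x :: w) j.+1 = size t1 + wpos w j by rewrite st1.
rewrite !e /=; move: hpos; rewrite addbN -addNb.
by case: (~~ odd k (+) o) => -[e1 e2]; lia.
Qed.

(* [Y (0, d)] is not modified before [z] and [Y (c, 0)] not after it: the two halves are glued
   over [z]. *)
Lemma fold_aux t pi c d p q : walk P t pi -> p < q ->
  rd t (Y (c, 0)) p q -> rd t (Y (0, d)) p q -> rd t P p q.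
Proof.
move=> hpi hpq /rd_walk [fa ha [a0 an]] /rd_walk [fb hb [b0 bn]].
have [ga0 gan gain [_ gap] [gale _]] := al_rigid hY (walk_comp ha hpi).
have [gb0 gbn gbin [_ gbp] [gble _]] := al_rigid hY (walk_comp hb hpi).
rewrite /= ?muln0 ?addn0 in ga0 gan gain gap gale gb0 gbn gbin gbp gble.
have ua := walk_unit ha; have ub := walk_unit hb.
have ea := al_size hY (c, 0); have eb := al_size hY (0, d); rewrite /= in ea eb.
have pn : size P > 0 by lia.
have uc := walk_unit (walk_comp hb hpi).
(* Over [P] this reading gets from 0 to [z + 1] in [z + 1] steps, so it never turns. *)
have gbE i : i <= z.+1 -> pi (fb i) = i.
  move=> hi; have [h1 _] := @unit_lip _ _ 0 i uc isT ltac:(lia).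
  have [h2 _] := @unit_lip _ _ i z.+1 uc hi ltac:(lia).
  by rewrite /= gb0 gbp in h1 h2; clear -h1 h2 hi; lia.
have fb1 : fb 1 = p.+1.
  have [//|h] : fb 1 = p.+1 \/ p = (fb 1).+1 by have := ub 0 ltac:(lia); rewrite b0.
  have [k hk ek] := @unit_ivt _ fb 1 (size (Y (0, d))) p ub ltac:(lia) (leqnn _) ltac:(lia).
  have hk2 : k <> size (Y (0, d)) by move=> e; subst k; lia.
  by have := gbin k ltac:(lia); rewrite ek -b0 gb0.
have fbE i : i <= z.+1 -> fb i = p + i.
  elim: i {-2}i (leqnn i) => [|i IH] [|j] hj hz; rewrite ?b0 ?addn0 //.
  case: j hj hz => [|j] hj hz; first by rewrite fb1 addn1.
  have e1 := IH j.+1 ltac:(lia) ltac:(lia); have e2 := IH j ltac:(lia) ltac:(lia).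
  have := ub j.+1 ltac:(lia); rewrite e1; case; first by lia.
  move=> h; have h' : fb j.+2 = fb j by lia.
  by have := gbE j.+2 hz; rewrite h' gbE //; lia.
have fage i : i <= size (Y (c, 0)) -> p <= fa i.
  move=> hi; rewrite leqNgt; apply/negP => h.
  have [k hk ek] := @unit_ivt _ fa i (size (Y (c, 0))) p ua hi (leqnn _) ltac:(lia).
  have k1 : k <> size (Y (c, 0)) by move=> e; subst k; lia.
  have k2 : k <> 0 by move=> e; subst k; have : i = 0 by [lia]; move=> e; subst i; lia.
  by have := gain k ltac:(lia); rewrite ek -a0 ga0.
(* The two readings meet at the vertex over [z + 1]. Vertices before it, already visited by [fb],
   lie over smaller numbers; and [fa] cannot have passed it earlier, since up to then it stays over
   vertices at most [z]. *)
have key : fa (z + 2 * c).+1 = p + z.+1.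
  have [h|h] := ltnP (fa (z + 2 * c).+1) (p + z.+1).
    have h1 := fage (z + 2 * c).+1 ltac:(lia).
    have e1 : fb (fa (z + 2 * c).+1 - p) = fa (z + 2 * c).+1 by rewrite fbE; lia.
    by have := gbE (fa (z + 2 * c).+1 - p) ltac:(lia); rewrite e1 gap; lia.
  have [k hk ek] := @unit_ivt _ fa 0 (z + 2 * c).+1 (p + z.+1) ua isT ltac:(lia) ltac:(lia).
  have [e|hlt] : k = (z + 2 * c).+1 \/ k <= z + 2 * c by lia.
    by rewrite -e.
  by have := gale k hlt; rewrite ek -fbE // gbp ltnn.
rewrite -(cat_take_drop z.+1 P); apply: (@rd_cat2 _ _ _ _ (p + z.+1)).
  rewrite -(al_take hY d) -{1}b0 -(fbE _ (leqnn _)).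
  have sz : size (take z.+1 (Y (0, d))) = z.+1 by rewrite size_take; case: ifP; lia.
  apply: (walk_slice hb); rewrite ?sz //; try lia.
  by move=> i hi; rewrite nth_take.
rewrite -(al_drop hY c) -an -key.
apply: (walk_slice ha); rewrite ?size_drop //; try lia.
by move=> i hi; rewrite nth_drop.
Qed.

Lemma letter_fold t pi c d p q : walk P t pi ->
  rd t (Y (c, 0)) p q -> rd t (Y (0, d)) p q -> rd t P p q.
Proof.
move=> hpi h1 h2.
have [hlt|hlt|e] := ltngtP p q; first exact: fold_aux hpi hlt h1 h2.
  have hp : p <= size t.
    case/rd_walk: h1 => f hf [<- _].
    by case: (step_bound (hf 0 _)) => //; apply: ltnW; apply: letter_size_gt1.
  have := @fold_aux (rp t) _ c d (size t - p) (size t - q) (walk_rp hpi) ltac:(lia)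
    (rd_rpt h1) (rd_rpt h2).
  by move/rd_rpt; rewrite rpK size_rp !subKn //; lia.
case/rd_walk: h1 => f hf [f0 fn].
have [g0 gn _ _ _] := al_rigid hY (walk_comp hf hpi).
by move: g0 gn; rewrite /= f0 fn e => ->; lia.
Qed.

(** [step] one level up: the states are the cuts between letters, and a letter may move across any
    larger letter in either direction. *)
Definition lstep (w : seq (nat * nat)) (x : nat * nat) (i k : nat) : Prop :=
  (k = i.+1 /\ i < size w /\ letter_le x (nth (0, 0) w i)) \/
  (i = k.+1 /\ k < size w /\ letter_le x (nth (0, 0) w k)).

Definition lrd (w : seq (nat * nat)) := reads (lstep w).

Lemma wbits_split o w k : k < size w -> wbits o w = wbits o (take k w) ++
  (if odd k (+) o then rp (Y (nth (0, 0) w k)) else Y (nth (0, 0) w k)) ++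
  wbits (~~ (odd k (+) o)) (drop k.+1 w).
Proof.
move=> hk; rewrite -{1}(cat_take_drop k w) (drop_nth (0, 0)) // wbits_cat /=.
by rewrite size_takel ?(ltnW hk) // addbC.
Qed.

Lemma letter_read w x k : k < size w -> letter_le x (nth (0, 0) w k) ->
  if odd k then rd (wbits false w) (Y x) (wpos w k.+1) (wpos w k)
  else rd (wbits false w) (Y x) (wpos w k) (wpos w k.+1).
Proof.
move=> hk /andP [h1 h2]; have h := al_le hY h1 h2.
rewrite (wbits_split false hk) (wposS (0, 0)) // addbF.
have e : wpos w k = size (wbits false (take k w)).
  by rewrite size_wbits /wpos take_size.
rewrite e; case: (odd k).
  have := @rd_embed (wbits false (take k w)) _ (wbits (~~ true) (drop k.+1 w)) _ _ _ (rd_rpt h).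
  by rewrite subn0 subnn addn0.
have := @rd_embed (wbits false (take k w)) _ (wbits (~~ false) (drop k.+1 w)) _ _ _ h.
by rewrite addn0.
Qed.

(** Every letter changes the position by one, so the parity of the position gives the orientation
    both of the letter read and of the letter met. *)
Lemma lrd_rd w w' i j : lrd w' w i j ->
  rd (wbits false w') (wbits (odd i) w) (wpos w' i) (wpos w' j).
Proof.
elim: w i => [|x w IH] i /=; first by move=> ->.
case=> k hk /IH h; apply: (@rd_cat2 _ _ _ _ (wpos w' k)).
  case: hk => -[e [hs hl]]; have := letter_read hs hl; rewrite e /=.
    by case: (odd i) => // /rd_rp.
  by case: (odd k) => // /rd_rp.
by move: h; have -> : odd k = ~~ odd i by case: hk => -[-> _]; rewrite ?negbK.
Qed.

Lemma rd_wbits t o w p q : rd t (wbits o w) p q -> exists beta, [/\ beta 0 = p,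
  beta (size w) = q & forall j, j < size w ->
    if odd j (+) o then rd t (Y (nth (0, 0) w j)) (beta j.+1) (beta j)
    else rd t (Y (nth (0, 0) w j)) (beta j) (beta j.+1)].
Proof.
elim: w o p => [|x w IH] o p /=; first by move=> ->; exists (fun _ => q).
case/rd_cat=> u h /IH [beta [b0 bn hb]].
exists (fun j => if j is j'.+1 then beta j' else p); split=> // -[|j] hj /=.
  by rewrite b0; move: h; case: (o) => // /rd_rp; rewrite rpK.
by have := hb j hj; rewrite addbN addNb.
Qed.

End Words.

(** * Coding a relation by words *)

(* In the order [letter_le], [lbot] is below everything, [llo] < [lhi] < [ltop], [ls] < [ltop], and
   there is no other comparison; any such pairs would do. *)
Definition la := (9, 0).
Definition lb := (0, 9).
Definition ls := (1, 5).
Definition lhi := (2, 3).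
Definition llo := (3, 4).
Definition ltop := (1, 1).
Definition lbot := (9, 9).

Section Code.
Variables (r : rel nat) (N : nat).
Hypothesis r_trans : forall i j k, r i j -> r j k -> r i k.
Hypothesis r_refl : forall i j, r i j -> r i i.

(* A code starts with the marker (la lb)^N, which cannot fold and is too long for the fixed part of
   the path; its bits then record which [i <= k] satisfy [r k i], and [ltop] absorbs the end of
   longer codes. *)
Definition code_letter (k i : nat) : nat * nat :=
  if i < 2 * N then (if odd i then lb else la) else
  if odd (i - 2 * N) then
    (if (i - 2 * N)./2 <= k then (if r k (i - 2 * N)./2 then llo else lhi) else ltop)
  else ls.

(** After the marker there is one pair of separator and bit for each index from 0 to [k + 1]; the
    last pair ends in [ltop]. *)
Definition code_len (k : nat) : nat := 2 * N + 2 * k + 4.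

Definition code (k : nat) : seq (nat * nat) := mkseq (code_letter k) (code_len k).

Definition slot (n k : nat) : seq (nat * nat) :=
  nseq (code_len k) lbot ++ (if r k n then code k else nseq (code_len k) lbot).

(* The slot of [k] starts with letters [lbot], along which a walk can return to the start of the
   code of any earlier index. *)
Fixpoint slots (n j : nat) : seq (nat * nat) :=
  if j is j'.+1 then slots n j' ++ slot n j' else [:: lbot; lbot].

Fixpoint slot_pos (j : nat) : nat :=
  if j is j'.+1 then slot_pos j' + 2 * code_len j' else 2.

Definition word (n : nat) : seq (nat * nat) := slots n n.+1.

Lemma size_slot n k : size (slot n k) = 2 * code_len k.
Proof. by rewrite size_cat size_nseq; case: ifP; rewrite ?size_mkseq ?size_nseq; lia. Qed.

Lemma size_slots n j : size (slots n j) = slot_pos j.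
Proof. by elim: j => //= j IH; rewrite size_cat IH size_slot. Qed.

(** Evenness makes every code begin with a letter read forwards. *)
Lemma odd_slot_pos j : odd (slot_pos j) = false.
Proof. by elim: j => //= j IH; rewrite oddD IH oddM. Qed.

Lemma odd_code_len j : odd (code_len j) = false.
Proof. by rewrite /code_len; lia. Qed.

Lemma nth_slots n j e : e < slot_pos j -> nth (0, 0) (slots n j) e = lbot \/
  exists k i, [/\ k < j, r k n, i < code_len k, e = slot_pos k + code_len k + i &
    nth (0, 0) (slots n j) e = code_letter k i].
Proof.
elim: j => [|j IH] /=; first by case: e => [|[|e]] // _; left.
move=> he; rewrite nth_cat size_slots; case: ltnP => h1.
  case: (IH h1) => [->|[k [i [hk hr hi hE ->]]]]; first by left.
  by right; exists k, i; split=> //; lia.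
rewrite /slot nth_cat size_nseq; case: ltnP => h2.
  by left; rewrite nth_nseq h2.
case: ifP => hr; last by left; rewrite nth_nseq; case: ifP => //; lia.
right; exists j, (e - slot_pos j - code_len j).
by split=> //; [lia|lia|rewrite nth_mkseq //; lia].
Qed.

Lemma nth_slots_code n j k i : k < j -> r k n -> i < code_len k ->
  nth (0, 0) (slots n j) (slot_pos k + code_len k + i) = code_letter k i.
Proof.
elim: j => // j IH hk hr hi /=; rewrite nth_cat size_slots.
have [e|hlt] : k = j \/ k < j by lia.
  subst k; rewrite ifF; last by lia.
  rewrite /slot nth_cat size_nseq ifF; last by lia.
  rewrite hr nth_mkseq; last by lia.
  by f_equal; lia.
have h : slot_pos k + 2 * code_len k <= slot_pos j.
  elim: j hlt {IH hk} => // j IH hlt /=.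
  have [e|h] : k = j \/ k < j by lia.
    by subst k; lia.
  by have := IH h; lia.
by rewrite ifT ?IH //; lia.
Qed.

Lemma code_letter_cases k i : [\/ code_letter k i = la, code_letter k i = lb,
  code_letter k i = ls | code_letter k i = llo \/ code_letter k i = lhi \/ code_letter k i = ltop].
Proof.
rewrite /code_letter; case: ifP => _.
  by case: ifP => _; [apply: Or42|apply: Or41].
case: ifP => _; last by apply: Or43.
by apply: Or44; do 2 (case: ifP => _; auto).
Qed.

Lemma lbot_le_slots n j e : e < slot_pos j -> letter_le lbot (nth (0, 0) (slots n j) e).
Proof.
case/(nth_slots n) => [->|[k [i [_ _ _ _ ->]]]] //.
by case: (code_letter_cases k i) => [->|->|->|[->|[->|->]]].
Qed.

(** The letter [(0, 0)] is [P] itself; its absence keeps [P] from being read in a word. *)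
Lemma slots_neq00 n j e : e < slot_pos j -> nth (0, 0) (slots n j) e <> (0, 0).
Proof.
case/(nth_slots n) => [->|[k [i [_ _ _ _ ->]]]] //.
by case: (code_letter_cases k i) => [->|->|->|[->|[->|->]]].
Qed.

Lemma la_le_code k i : letter_le la (code_letter k i) -> i < 2 * N /\ odd i = false.
Proof.
rewrite /code_letter; case: ltnP => _; first by case: (odd i).
by case: (odd _) => //; case: (_ <= k) => //; case: (r _ _).
Qed.

Lemma lb_le_code k i : letter_le lb (code_letter k i) -> i < 2 * N /\ odd i.
Proof.
rewrite /code_letter; case: ltnP => _; first by case: (odd i).
by case: (odd _) => //; case: (_ <= k) => //; case: (r _ _).
Qed.

Lemma ls_le_code k i : letter_le ls (code_letter k i) -> 2 * N <= i.
Proof. by rewrite /code_letter; case: ltnP => // _; case: (odd i). Qed.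

Lemma letter_lexx x : letter_le x x.
Proof. by rewrite /letter_le !leqnn. Qed.

Lemma lrd_pointwise w' w i : i + size w <= size w' ->
  (forall e, e < size w -> letter_le (nth (0, 0) w e) (nth (0, 0) w' (i + e))) ->
  lrd w' w i (i + size w).
Proof.
elim: w i => [|x w IH] i /=; first by rewrite addn0.
move=> hs h; exists i.+1; last first.
  rewrite -addSnnS; apply: IH => [|e he]; first by lia.
  by have := h e.+1 he; rewrite addSnnS.
left; split=> //; split; first by lia.
by have := h 0 isT; rewrite addn0.
Qed.

Lemma lrd_lbot n j L p q : p <= slot_pos j -> q <= slot_pos j -> p <= q + L -> q <= p + L ->
  odd (p + q + L) = false -> lrd (slots n j) (nseq L lbot) p q.
Proof.
elim: L p => [|L IH] p hp hq h1 h2 h3 /=; first by rewrite (_ : p = q) //; lia.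
have pos : 0 < slot_pos j by elim: (j) => //= k; lia.
have fwd u : u < slot_pos j -> lstep (slots n j) lbot u u.+1.
  by move=> hu; left; rewrite size_slots; split=> //; split=> //; apply: lbot_le_slots.
have bwd u : u < slot_pos j -> lstep (slots n j) lbot u.+1 u.
  by move=> hu; right; rewrite size_slots; split=> //; split=> //; apply: lbot_le_slots.
have [h|h] := ltnP p q.
  by exists p.+1; [apply: fwd; lia|apply: IH; lia].
case: p hp h1 h2 h3 h => [|p] hp h1 h2 h3 h.
  by exists 1; [apply: fwd; lia|apply: IH; lia].
by exists p; [apply: bwd; lia|apply: IH; lia].
Qed.

(** By transitivity [r n i] implies [r k i], so an [llo] of the code of [n] meets an [llo]; [lhi]
    accepts both bits, and past the bit of [n] stands [ltop]. *)
Lemma code_letter_le k n i : n <= k -> r k n -> i < code_len n ->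
  letter_le (code_letter k i) (code_letter n i).
Proof.
rewrite /code_len /code_letter => hkn hr hi; case: ifP => h1; first exact: letter_lexx.
case: ifP => h2 //.
have [h3|h3] := leqP ((i - 2 * N)./2) n.
  rewrite (leq_trans h3 hkn); case h4 : (r n _).
    by rewrite (r_trans hr h4).
  by case: (r k _).
by case: ifP => _ //; case: ifP.
Qed.

Lemma code_letter_le_top k i : 2 * N <= i -> letter_le (code_letter k i) ltop.
Proof.
rewrite /code_letter => h; rewrite ifF; last by lia.
by case: ifP => // _; case: ifP => // _; case: ifP.
Qed.

Lemma code_letter_last n : code_letter n (code_len n).-1 = ltop.
Proof.
rewrite /code_letter /code_len ifF; last by lia.
by rewrite ifT; [rewrite ifF //; lia|lia].
Qed.

Lemma lrd_code n k : n <= k -> r k n -> r n n ->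
  lrd (word n) (code k) (slot_pos n + code_len n) (slot_pos n.+1).
Proof.
move=> hnk hkn hnn; apply/(reads_fun (0, 0)).
have ln : 2 * N <= code_len n /\ 0 < code_len n /\ code_len n <= code_len k.
  by rewrite /code_len; lia.
have ok := odd_code_len k; have on := odd_code_len n.
(* Once the code of [n] is used up, the walk goes back and forth across its last letter [ltop]. *)
exists (fun i => slot_pos n + code_len n +
  (if i <= code_len n then i else code_len n - odd (i - code_len n))); split.
- by rewrite leq0n addn0.
- by rewrite size_mkseq /=; case: ifP => h; lia.
rewrite size_mkseq => i hi; rewrite nth_mkseq // /lstep size_slots /=.
have [h|h] := ltnP i (code_len n).
  left; rewrite (ltnW h); split; first by lia.
  split; first by lia.
  rewrite nth_slots_code //; exact: code_letter_le.
have top : nth (0, 0) (word n) (slot_pos n + code_len n + (code_len n).-1) = ltop.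
  by rewrite nth_slots_code ?code_letter_last //; lia.
have hl : letter_le (code_letter k i) ltop by apply: code_letter_le_top; lia.
have [od|od] := boolP (odd (i - code_len n)).
  left; rewrite ifF; last by lia.
  have e : slot_pos n + code_len n + (code_len n - 1) = slot_pos n + code_len n + (code_len n).-1 by lia.
  split; first by have -> : odd (i.+1 - code_len n) = false by [lia]; lia.
  by split; [lia|rewrite e top].
right; have -> : odd (i.+1 - code_len n) by lia.
have -> : (if i <= code_len n then i else code_len n - false) = code_len n by case: ifP => hc; lia.
have e : slot_pos n + code_len n + (code_len n - true) = slot_pos n + code_len n + (code_len n).-1 by lia.
by split; [lia|split; [lia|rewrite e top]].
Qed.

Lemma lrd_word m n : r m n -> r n n -> exists q, lrd (word n) (word m) 0 q.
Proof.
move=> hmn hnn.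
(* Since [r k m] implies [r k n], the common slots of the word of [n] have a code wherever those of
   [m] have one. *)
have pw j : j <= n.+1 -> lrd (word n) (slots m j) 0 (slot_pos j).
  move=> hj; rewrite -(size_slots m j) -[X in lrd _ _ _ X]add0n.
  have mono i : slot_pos j <= slot_pos (j + i).
    by elim: i => [|i IH]; rewrite ?addn0 ?addnS //=; lia.
  have hle : slot_pos j <= slot_pos n.+1 by have := mono (n.+1 - j); rewrite subnKC.
  apply: lrd_pointwise => [|e]; rewrite ?size_slots // => he; rewrite add0n.
  have he' := leq_trans he hle.
  case: (nth_slots m he) => [->|[k [i [hk hr hi -> ->]]]]; first exact: lbot_le_slots.
  rewrite nth_slots_code ?letter_lexx //; first exact: leq_trans hk hj.
  exact: r_trans hr hmn.
have [hle|hlt] := leqP m n; first by exists (slot_pos m.+1); apply: pw.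
exists (slot_pos n.+1).
(* A slot of index above [n] makes a loop at the end of the word: its letters [lbot] go back to the
   start of the code of [n], and its code, or further letters [lbot], return to the end. *)
suff H d : lrd (word n) (slots m (n.+1 + d)) 0 (slot_pos n.+1).
  by have := H (m - n); have -> : n.+1 + (m - n) = m.+1 by lia.
elim: d => [|d IH]; first by rewrite addn0; apply: pw.
rewrite addnS /=; apply/reads_cat; exists (slot_pos n.+1) => //.
set k := n.+1 + d; apply/reads_cat; exists (slot_pos n + code_len n).
  apply: lrd_lbot; rewrite /= ?/code_len; try lia.
case: ifP => hk.
  by apply: lrd_code => //; [rewrite /k; lia|apply: r_trans hk hmn].
by apply: lrd_lbot; rewrite /= /code_len; lia.
Qed.

End Code.

(** * Recovering the relation from a homomorphism *)

Section Reflect.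
Variables (P : opath) (z : nat) (Y : nat * nat -> opath).
Hypothesis hY : alphabet P z Y.
Variables (R : opath) (e0 : nat).
Hypotheses (hR : rd P R e0 0) (hPR : ~ hom P R).
Variables (r : rel nat).
Hypothesis r_trans : forall i j k, r i j -> r j k -> r i k.
Hypothesis r_refl : forall i j, r i j -> r i i.

(** The marker has [2 * N] letters and each moves by at least one vertex, so following it in one
    direction leads beyond the vertices of [R]. *)
Let N := (size R).+1.

Definition code_path (n : nat) : opath := R ++ wbits Y false (word r N n).

Lemma wbits_proj o w : exists q, rd P (wbits Y o w) (if o then size P else 0) q.
Proof.
elim: w o => [|x w IH] o /=; first by eexists.
have h : rd P (Y x) 0 (size P).
  by have := @al_le _ _ _ hY x (0, 0) isT isT; rewrite (al_zero hY).
have [q hq] := IH (~~ o); exists q; apply: rd_cat2 hq.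
by case: (o) => //=; apply: rd_rp.
Qed.

Lemma code_path_proj n : exists2 pi, walk P (code_path n) pi & pi 0 = e0.
Proof.
have [q hq] := wbits_proj false (word r N n).
have /rd_walk [pi hpi [p0 _]] := rd_cat2 hR hq.
by exists pi.
Qed.

Lemma code_path_mono m n : r m n -> r n n ->
  hom (code_path m) (code_path n).
Proof.
move=> hmn hnn; have [q hq] := @lrd_word r N r_trans m n hmn hnn.
have h := lrd_rd hY hq; rewrite wpos0 in h.
apply/homP; exists 0, (size R + wpos Y (word r N n) q); split=> //.
apply: (@rd_cat2 _ _ _ _ (size R)).
  by have := @rd_embed [::] R (wbits Y false (word r N n)) _ _ _ (rd_self R).
by have := @rd_embed R _ [::] _ _ _ h; rewrite cats0 addn0.
Qed.

Section Target.
Variable n : nat.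
Let Q := code_path n.
Let w := word r N n.
Let wp := wpos Y w.
Variable pi : nat -> nat.
Hypothesis hpi : walk P Q pi.

Lemma locate l p q : rd Q (Y l) p q ->
  [/\ p <= size R, q <= size R & rd R (Y l) p q] \/
  exists k, [/\ k < slot_pos N n.+1, letter_le l (nth (0, 0) w k) &
    if odd k then p = size R + wp k.+1 /\ q = size R + wp k
    else p = size R + wp k /\ q = size R + wp k.+1].
Proof.
have h2 : walk P (wbits Y false w) (fun i => pi (size R + i)).
  by have := @walk_shift _ _ _ (size R) hpi; rewrite drop_size_cat.
(* The word begins with a letter read forwards, whose start is sent to 0 by every projection; so [R]
   and the word meet over an end of [P]. *)
have hcut : pi (size R) = 0.
  rewrite -[size R]addn0; move: h2; rewrite -(cat_take_drop 1 w).
  have -> : take 1 w = [:: lbot].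
    rewrite /w /word; elim: (n.+1) => // j IH /=.
    by rewrite takel_cat // size_slots; elim: (j) => //= k; lia.
  move=> h; have := @walk_infix P [::] (Y lbot) (wbits Y true (drop 1 w)) _ h.
  by case/(al_rigid hY).
move=> h; have [|[hp hq h']] := letter_cut hY hpi (or_introl hcut) h; [by left|right].
have [k [hk hl hpos]] := letter_in_word hY h2 h'.
exists k; rewrite size_slots in hk; split=> //; rewrite addbF in hpos.
by case: (odd k) hpos => -[e1 e2]; rewrite -/wp in e1 e2; lia.
Qed.

Lemma rd_ends l p q : rd Q (Y l) p q -> [/\ pi p = 0, pi q = size P, p <> q &
  forall t, minn p q < t < maxn p q -> 0 < pi t < size P].
Proof.
case/rd_walk=> f hf [f0 fn]; have zP := al_z hY.
have [g0 gn gin _ _] := al_rigid hY (walk_comp hf hpi); rewrite /= f0 fn in g0 gn gin.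
have u := walk_unit hf; split=> //.
  by move=> e; move: g0 gn; rewrite e => ->; lia.
move=> t ht.
have [k hk ek] := @unit_ivt _ f 0 (size (Y l)) t u isT (leqnn _) ltac:(lia).
have k0 : k <> 0 by move=> e; subst k; lia.
have k1 : k <> size (Y l) by move=> e; subst k; lia.
by rewrite -ek; apply: gin; lia.
Qed.

(** Both letters on one segment would put [P] there. It does not map to [R], and in the word it
    would need the letter [(0, 0)]. *)
Lemma no_fold c d p q : rd Q (Y (c, 0)) p q -> rd Q (Y (0, d)) p q -> False.
Proof.
move=> h1 h2; have := letter_fold hY hpi h1 h2.
rewrite -{1}(al_zero hY) => /locate [[hp hq]|[k [hk hl _]]].
  by rewrite (al_zero hY) => h; apply: hPR; apply/homP; exists p, q.
apply: (@slots_neq00 r N n n.+1 k hk).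
by move: hl; rewrite /letter_le -/w /w /word; case: (nth _ _ k) => a b /=; case: a; case: b.
Qed.

Lemma wp_lt i j : i < j -> j <= slot_pos N n.+1 -> wp i < wp j.
Proof. by move=> hij hj; apply: (wpos_lt hY) => //; rewrite size_slots. Qed.

Lemma wp_inj i j : i <= slot_pos N n.+1 -> j <= slot_pos N n.+1 -> wp i = wp j -> i = j.
Proof. by move=> hi hj; apply: (wpos_inj hY); rewrite size_slots. Qed.

Section Source.
Variables (m : nat) (B : nat -> nat).
Hypothesis hB : forall i, i < code_len N m ->
  if odd i then rd Q (Y (code_letter r N m i)) (B i.+1) (B i)
  else rd Q (Y (code_letter r N m i)) (B i) (B i.+1).

Let len_gt : 2 * N + 4 <= code_len N m.
Proof. by rewrite /code_len; lia. Qed.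

Lemma marker_letter i : i < 2 * N -> code_letter r N m i = if odd i then lb else la.
Proof. by rewrite /code_letter => ->. Qed.

Lemma marker_ends i : i < 2 * N -> [/\ pi (B i) = 0 \/ pi (B i) = size P, B i <> B i.+1 &
  forall t, minn (B i) (B i.+1) < t < maxn (B i) (B i.+1) -> 0 < pi t < size P].
Proof.
move=> hi; have := hB (i := i) ltac:(lia); case: (odd i) => /rd_ends [h1 h2 h3 h4].
  by split=> [||t]; [right|move=> e; apply: h3|rewrite minnC maxnC; apply: h4].
by split=> //; left.
Qed.

(** If the walk turned back, the segments of two consecutive letters would either coincide, which
    cannot happen for [la] and [lb], or one would have an end inside the other, over an inner vertex
    of [P]. *)
Lemma marker_mono i : i.+1 < 2 * N -> (B i < B i.+1) = (B i.+1 < B i.+2).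
Proof.
move=> hi; have [s0 n0 i0] := marker_ends (ltnW hi); have [s1 n1 i1] := marker_ends hi.
have nf : B i <> B i.+2.
  have := hB (i := i) ltac:(lia); have := hB (i := i.+1) ltac:(lia).
  rewrite !marker_letter //= ?(ltnW hi) //; case: (odd i) => /= h1 h2 e.
    by rewrite -e in h1; exact: no_fold h1 h2.
  by rewrite -e in h1; exact: no_fold h2 h1.
have s2 : pi (B i.+2) = 0 \/ pi (B i.+2) = size P.
  have := hB (i := i.+1) ltac:(lia).
  by case: (odd i.+1) => /rd_ends [h1 h2 _ _]; [left|right].
have sp t : pi t = 0 \/ pi t = size P -> ~~ (0 < pi t < size P).
  by case=> ->; rewrite ?ltnn ?andbF.
have z0 := sp _ s0; have z2 := sp _ s2.
have j0 : ~~ (minn (B i.+1) (B i.+2) < B i < maxn (B i.+1) (B i.+2)).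
  by apply/negP => /i1 h; rewrite h in z0.
have j2 : ~~ (minn (B i) (B i.+1) < B i.+2 < maxn (B i) (B i.+1)).
  by apply/negP => /i0 h; rewrite h in z2.
clear -j0 j2 nf n0 n1; lia.
Qed.

Lemma marker_up i : B 0 < B 1 -> i <= 2 * N -> B 0 + i <= B i /\ (i < 2 * N -> B i < B i.+1).
Proof.
move=> h0; elim: i => [|i IH] hi; first by rewrite addn0.
have [h1 h2] := IH (ltnW hi); have h3 := h2 hi.
by split=> [|h4]; [lia|rewrite -marker_mono].
Qed.

Lemma marker_down i : B 1 < B 0 -> i <= 2 * N -> B i + i <= B 0 /\ (i < 2 * N -> B i.+1 < B i).
Proof.
move=> h0; elim: i => [|i IH] hi; first by rewrite addn0.
have [h1 h2] := IH (ltnW hi); have h3 := h2 hi.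
split=> [|h4]; first by lia.
have [_ n1 _] := marker_ends h4; have := marker_mono h4; clear -h3 n1; lia.
Qed.

(** A descent along the whole marker would have to start beyond [R], so its first [la] would be read
    on an [la] of the word. Those stand at even positions and are read upwards. *)
Lemma marker_is_up : B 0 < B 1.
Proof.
have [_ n0 _] := marker_ends (i := 0) ltac:(rewrite /N; lia).
have [//|h] : B 0 < B 1 \/ B 1 < B 0 by lia.
exfalso; have [h1 _] := marker_down h (leqnn _).
have := hB (i := 0) ltac:(lia); rewrite marker_letter; last by rewrite /N; lia.
rewrite /= => /locate [[hp _ _]|[k [hk hl]]]; first by move: hp h1; rewrite /N; lia.
have := nth_slots r n hk; case=> [e|[k' [i [hk' hr hi hkE e]]]].
  by move: hl; rewrite /w /word e.
move: hl; rewrite /w /word e => /la_le_code [_ oi].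
have -> : odd k = false.
  by have := odd_slot_pos N k'; have := odd_code_len N k'; clear -hkE oi; lia.
by case=> e1 e2; have := wp_lt (ltnSn k) hk; lia.
Qed.

(** Having left [R], the last [lb] is read on an [lb] of some code. The following [ls] cannot go
    back across it, and going on it fits no marker letter; so the marker of that code ends at the
    same place. *)
Lemma marker_end : exists k, [/\ k < n.+1, r k n &
  B (2 * N) = size R + wp (slot_pos N k + code_len N k + 2 * N)].
Proof.
have [h1 _] := marker_up marker_is_up (leqnn (2 * N)).
have [_ h2] := marker_up (i := (2 * N).-1) marker_is_up ltac:(lia).
have e2 : (2 * N).-1.+1 = 2 * N by rewrite /N; lia.
rewrite e2 in h2; have {}h2 := h2 ltac:(rewrite /N; lia).
have ob : odd (2 * N).-1 by rewrite /N; lia.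
have := hB (i := (2 * N).-1) ltac:(lia).
rewrite marker_letter; last by rewrite /N; lia.
rewrite ob e2 => /locate [[hp _ _]|[k [hk hl hpos]]].
  by move: hp h1; rewrite /N; lia.
have ek : B (2 * N) = size R + wp k.+1.
  have := wp_lt (ltnSn k) hk; case: (odd k) hpos => -[h3 h4] //; clear -h3 h4 h2; lia.
have := hB (i := 2 * N) ltac:(lia).
have -> : odd (2 * N) = false by lia.
have -> : code_letter r N m (2 * N) = ls by rewrite /code_letter ltnn subnn.
move=> /locate [[hp _ _]|[k2 [hk2 hl2 hpos2]]].
  by move: hp h1; rewrite /N; lia.
have := nth_slots r n hk; case=> [e|[k' [i [hk' hr hi hkE e]]]].
  by move: hl; rewrite /w /word e.
move: (hl); rewrite /w /word e => /lb_le_code [hiN oi].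
have ek2 : k2 = k.+1.
  case: (odd k2) hpos2 => -[h3 _].
    have : k.+1 = k2.+1 by apply: wp_inj => //; lia.
    move=> [e3]; exfalso; subst k2; move: hl2; rewrite /w /word e.
    by rewrite /code_letter hiN oi.
  by apply: wp_inj; lia.
subst k2.
have hi1 : i.+1 < code_len N k' by rewrite /code_len; lia.
have e4 : k.+1 = slot_pos N k' + code_len N k' + i.+1 by lia.
have e5 : nth (0, 0) w k.+1 = code_letter r N k' i.+1.
  by rewrite e4 /w /word nth_slots_code.
move: hl2; rewrite e5 => /ls_le_code h5.
exists k'; split=> //; rewrite ek; do 2 f_equal; lia.
Qed.

Lemma reflect_code : r m m -> r m n.
Proof.
move=> hmm; have [k [hk hkn e0']] := marker_end.
set base := slot_pos N k + code_len N k + 2 * N in e0'.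
have hbase : base + 2 * k + 4 <= slot_pos N n.+1.
  have mono i j : i <= j -> slot_pos N i <= slot_pos N j.
    by elim: j => [|j IH]; [case: i|rewrite leq_eqVlt => /orP [/eqP -> //|/IH] /=; lia].
  by have := mono _ _ hk; rewrite /base /= /code_len; lia.
have ob : odd base = false.
  have := odd_slot_pos N k; have := odd_code_len N k; rewrite /base; clear; lia.
have wk i : i < 2 * k + 4 -> nth (0, 0) w (base + i) = code_letter r N k (2 * N + i).
  move=> hi; rewrite /base -addnA /w /word nth_slots_code //; rewrite /code_len; lia.
have back : nth (0, 0) w base.-1 = lb.
  have -> : base.-1 = slot_pos N k + code_len N k + (2 * N).-1 by rewrite /base /N; lia.
  rewrite /w /word nth_slots_code //; last by rewrite /code_len; lia.
  rewrite /code_letter ifT; last by rewrite /N; lia.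
  by rewrite ifT //; rewrite /N; lia.
have bpos : 0 < base by rewrite /base /N; lia.
have cl a i : code_letter r N a (2 * N + i) =
    if odd i then (if i./2 <= a then (if r a i./2 then llo else lhi) else ltop) else ls.
  by rewrite /code_letter ifF ?addKn //; lia.
have stepB i : i < 2 * m + 4 -> i < 2 * k + 4 -> B (2 * N + i) = size R + wp (base + i) ->
    (B (2 * N + i.+1) = size R + wp (base + i.+1) /\
       letter_le (code_letter r N m (2 * N + i)) (code_letter r N k (2 * N + i))) \/
    letter_le (code_letter r N m (2 * N + i)) (nth (0, 0) w (base + i).-1).
  move=> him hik hBi; have := hB (i := 2 * N + i) ltac:(rewrite /code_len; lia).
  have -> : odd (2 * N + i) = odd i by lia.
  have pos : 0 < wp (base + i).
    have : wp 0 < wp (base + i) by apply: wp_lt; clear -bpos hik hbase; lia.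
    by lia.
  rewrite -addnS; case oi : (odd i) => /locate [[h1 h2 _]|[k2 [hk2 hl hpos]]]; try lia.
    case o2 : (odd k2) hpos => -[h1 h2]; last first.
      have ee : k2.+1 = base + i by apply: wp_inj; lia.
      by right; rewrite -ee.
    have ee : k2 = base + i by apply: wp_inj; lia.
    by left; rewrite (addnS base) -ee; split=> //; rewrite -wk // -ee.
  case o2 : (odd k2) hpos => -[h1 h2].
    have ee : k2.+1 = base + i by apply: wp_inj; lia.
    by right; rewrite -ee.
  have ee : k2 = base + i by apply: wp_inj; lia.
  by left; rewrite (addnS base) -ee; split=> //; rewrite -wk // -ee.
(* Stepping back is impossible: separators and bits are incomparable, and [ls] is not below [lb].
   The range stops where the previous letter could be [ltop], which lies above [ls]. *)
have fwd i : i <= 2 * minn m k + 2 -> B (2 * N + i) = size R + wp (base + i) ->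
    B (2 * N + i.+1) = size R + wp (base + i.+1) /\
    letter_le (code_letter r N m (2 * N + i)) (code_letter r N k (2 * N + i)).
  move=> hi hBi; case: (stepB i) => //; try lia.
  rewrite cl; case: i hi hBi => [|i] hi hBi; first by rewrite addn0 back.
  rewrite addnS wk ?cl; last by lia.
  have [oi|oi] := boolP (odd i).
    rewrite /= oi /=.
    rewrite (_ : i./2 <= k); last by lia.
    by case: (r k _).
  rewrite /= oi (_ : uphalf i <= m); last by lia.
  by case: (r m _).
have reach i : i <= 2 * minn m k + 3 -> B (2 * N + i) = size R + wp (base + i).
  elim: i => [|i IH] hi; first by rewrite !addn0.
  by case: (fwd i) => //; [lia|apply: IH; lia].
(* If [m < k], the final [ltop] of the code of [m] would have to be read on a bit of the code of
   [k]. *)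
have [hlt|hge] := ltnP m k.
  have := stepB (2 * m + 3) ltac:(lia) ltac:(lia) (reach (2 * m + 3) ltac:(lia)).
  have o3 : odd (2 * m + 3) by lia.
  have h3 : (2 * m + 3)./2 = m.+1 by lia.
  have -> : (base + (2 * m + 3)).-1 = base + (2 * m + 2) by lia.
  rewrite wk; last by lia.
  rewrite !cl o3 h3 ltnn hlt (_ : odd (2 * m + 2) = false); last by lia.
  by case: (r k _) => -[[]|].
(* The bit for [k] in the code of [k] is [llo] by reflexivity, and among the two bits only [llo]
   lies below it; so the code of [m] shows [r m k]. *)
have [_] := fwd (2 * k + 1) ltac:(lia) (reach (2 * k + 1) ltac:(lia)).
rewrite !cl (_ : odd (2 * k + 1)); last by lia.
rewrite (_ : (2 * k + 1)./2 = k); last by lia.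
rewrite leqnn hge (r_refl hkn); case hmk : (r m k) => // _.
exact: r_trans hmk hkn.
Qed.

End Source.
End Target.

Lemma code_path_reflect m n : r m m -> hom (code_path m) (code_path n) -> r m n.
Proof.
move=> hmm /homP [x [y [_ /rd_cat [u _ /rd_wbits [beta [_ _ hb]]]]]].
have [pi hpi _] := code_path_proj n.
(* As [r m m] holds, the word of [m] contains the code of [m], and it begins at [J]. *)
pose J := slot_pos N m + code_len N m.
apply: (@reflect_code n pi hpi m (fun i => beta (J + i))) => // i hi.
have oJ : odd J = false.
  have := odd_slot_pos N m; have := odd_code_len N m; rewrite /J; clear; lia.
have := hb (J + i); rewrite size_slots /= addbF oddD oJ /= /word nth_slots_code //.
rewrite -addnS; apply; rewrite /J; lia.
Qed.

End Reflect.

(** * Universality *)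

Lemma unit_monotone n f : unit_steps n f -> (forall i, i.+2 <= n -> f i <> f i.+2) ->
  (forall i, i <= n -> f i = f 0 + i) \/ (forall i, i <= n -> f 0 = f i + i).
Proof.
move=> hf hi; case: n hf hi => [|n] hf hi.
  by left=> i hi'; have -> : i = 0 by [lia]; rewrite addn0.
have [h|h] := hf 0 isT; [left|right] => i; elim: i {-2}i (leqnn i) => [|k IH] [|[|i]] hk hin;
  rewrite ?addn0 ?addn1 //.
- have e1 := IH i.+1 ltac:(lia) (ltnW hin); have e2 := IH i ltac:(lia) ltac:(lia).
  by have := hf i.+1 hin; have := hi i hin; clear -e1 e2; lia.
- have e1 := IH i.+1 ltac:(lia) (ltnW hin); have e2 := IH i ltac:(lia) ltac:(lia).
  by have := hf i.+1 hin; have := hi i hin; clear -e1 e2; lia.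
Qed.

(* Goes down from [e] to 1 and then to 2, 1, 0: the turn at 2 prevents [P] from being traversed
   straight. *)
Definition tail (P : opath) (e : nat) : opath :=
  if e == 0 then [::] else
  rp (drop 1 (take e P)) ++ [:: nth false P 1; ~~ nth false P 1; ~~ nth false P 0].

Definition tail_pos (e j : nat) : nat :=
  if j < e then e - j else if j == e then 2 else if j == e.+1 then 1 else 0.

Lemma size_tail P e : 0 < e <= size P -> size (tail P e) = e.+2.
Proof.
rewrite /tail => he; rewrite ifF; last by lia.
by rewrite size_cat size_rp size_drop size_take /=; case: ifP; lia.
Qed.

Lemma tail_walk P e j : 0 < e <= size P -> 1 < size P -> j < e.+2 ->
  step P (nth false (tail P e) j) (tail_pos e j) (tail_pos e j.+1).
Proof.
move=> he hP hj; rewrite /tail ifF; last by lia.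
have s1 : size (drop 1 (take e P)) = e.-1 by rewrite size_drop size_take; case: ifP; lia.
rewrite nth_cat size_rp s1; case: ltnP => h1.
  right; rewrite /tail_pos ifT; last by lia.
  rewrite ifT; last by lia.
  rewrite nth_rp ?s1 // nth_drop nth_take; last by lia.
  split; [lia|split; [lia|]]; rewrite negbK; f_equal; lia.
have tp1 : tail_pos e e.-1 = 1 by rewrite /tail_pos; split_ifs; lia.
have tp2 : tail_pos e e = 2 by rewrite /tail_pos; split_ifs; lia.
have tp3 : tail_pos e e.+1 = 1 by rewrite /tail_pos; split_ifs; lia.
have tp4 : tail_pos e e.+2 = 0 by rewrite /tail_pos; split_ifs; lia.
have [e1|[e1|e1]] : j = e.-1 \/ j = e \/ j = e.+1 by lia.
- subst j; rewrite subnn prednK; last by lia.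
  by rewrite tp1 tp2; left.
- subst j; have -> : e - e.-1 = 1 by lia.
  by rewrite tp2 tp3; right; rewrite /= negbK.
- subst j; have -> : e.+1 - e.-1 = 2 by lia.
  by rewrite tp3 tp4; right; rewrite /= negbK; split=> //; split=> //; lia.
Qed.

Lemma walk_cat P s t f g : walk P s f -> walk P t g -> f (size s) = g 0 ->
  walk P (s ++ t) (fun i => if i <= size s then f i else g (i - size s)).
Proof.
move=> hf hg e i; rewrite size_cat nth_cat => hi.
have [h|h] := ltnP i (size s); first by rewrite (ltnW h); apply: hf.
have := hg (i - size s) ltac:(lia); rewrite -subSn //.
case: ifP => // h'; have -> : i = size s by lia.
by rewrite subnn e.
Qed.

(** Followed by the projection, a map from [P] would be the identity by rigidity, so it would run
    along the extended path without turning. Forwards it stays in [P1], because past its first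
    vertex the tail never comes to [size P]. Backwards it either stays in [P1] or starts at the end
    of the tail, and then its fourth vertex lies over 1 instead of 3. *)
Lemma extend_to_zero P P1 : rigid P -> 2 < size P -> hom P1 P -> ~ hom P P1 ->
  exists F e0, [/\ e0 <= size P, rd P (P1 ++ F) e0 0 & ~ hom P (P1 ++ F)].
Proof.
move=> hr hn /homP [e0 [e [he0 hrd]]] hno; have hle := rd_bound he0 hrd.
exists (tail P e), e0; have [z0|pos] := posnP e.
  by rewrite /tail z0 eqxx cats0; split=> //; rewrite -z0.
have he : 0 < e <= size P by rewrite pos.
have hst := size_tail he.
have ht : walk P (tail P e) (tail_pos e).
  by move=> j; rewrite hst; apply: tail_walk => //; lia.
have [t0 tn] : tail_pos e 0 = e /\ tail_pos e e.+2 = 0.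
  by rewrite /tail_pos pos subn0; split=> //; do 3 (case: ifP => //; try lia).
case/rd_walk: hrd => f hf [f0 fn].
have hpi := walk_cat hf ht; rewrite fn t0 in hpi; have {}hpi := hpi erefl.
set pi := (fun i => _) in hpi.
split=> //.
  apply/rd_walk; exists pi => //; rewrite /pi /= f0 size_cat hst; split=> //.
  by case: ifP => hh; [lia|rewrite addKn].
case/homP=> x [y [hx /rd_walk [h hh [h0 hy]]]].
have hb i : i <= size P -> h i <= size P1 + e.+2.
  case: i => [_|i hi]; first by rewrite h0; rewrite size_cat hst in hx.
  by case: (step_bound (hh i hi)); rewrite size_cat hst.
have hw := walk_comp hh hpi.
have b0 : pi (h 0) <= size P by case: (step_bound (hw 0 ltac:(lia))).
have [p0 pn] := hr _ _ b0 (proj2 (rd_walk _ _ _ _) (ex_intro2 _ _ _ hw (conj erefl erefl))).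
rewrite /= in p0 pn.
have pE i : i <= size P -> pi (h i) = i.
  move=> hi; have [h1 _] := @unit_lip _ _ 0 i (walk_unit hw) isT hi.
  have [h2 _] := @unit_lip _ _ i (size P) (walk_unit hw) hi (leqnn _).
  by rewrite /= p0 pn in h1 h2; clear -h1 h2 hi; lia.
have hn1 : h (size P) <= size P1.
  rewrite leqNgt; apply/negP => hgt.
  have := pE _ (leqnn (size P)); rewrite /pi leqNgt hgt /= /tail_pos.
  by split_ifs; lia.
have hinj i : i.+2 <= size P -> h i <> h i.+2.
  by move=> hi e1; have := pE i.+2 hi; rewrite -e1 pE; lia.
have fin : (forall i, i <= size P -> h i <= size P1) -> False.
  move=> hall; apply: hno; apply/homP; exists (h 0), (h (size P)); split; first exact: hall.
  have := @walk_restrict [::] P1 (tail P e) P h hh; rewrite /= !subn0; apply=> i hi.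
  by rewrite add0n hall.
have [hm|hm] := unit_monotone (walk_unit hh) hinj.
  by apply: fin => i hi; have := hm i hi; have := hm _ (leqnn _); lia.
have [h01|h01] := leqP (h 0) (size P1).
  by apply: fin => i hi; have := hm i hi; lia.
have e1 : h 0 = size P1 + e.+2.
  have := p0; rewrite /pi leqNgt h01 /= /tail_pos; have := hb 0 isT.
  by split_ifs; lia.
have := hm 3 hn; rewrite e1 => e2.
have e3 : h 3 = size P1 + e.-1 by lia.
have := pE 3 hn; rewrite /pi e3; case: ifP => h1.
  have e4 : e = 1 by lia.
  by rewrite e4 addn0 fn e4.
by rewrite addKn /tail_pos ifT; lia.
Qed.

Lemma universal_above P1 P h : rigid P -> is_height P h -> 4 <= h -> hom P1 P -> ~ hom P P1 ->
  interval_universal P1 P.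
Proof.
move=> hr hh h4 h1 h2.
have hn : 2 < size P.
  have [G [hG _ [i hi ei] [j hj ej]]] := height_level hh.
  have uG := walk_unit hG; have [hij|hij] := leqP i j.
    by have [? _] := unit_lip uG hij hj; lia.
  by have [_ [? _]] := unit_lip uG (ltnW hij) hi; lia.
have [z [Y hY]] := alphabet_exists hr hh h4.
have [F [e0 [he0 hR hPR]]] := extend_to_zero hr hn h1 h2.
move=> T le [g ginj] [le_refl [_ le_trans]].
(* Numbers outside the image of [g] are related to nothing, so [r] is reflexive only on that
   image. *)
pose rel_le i j := exists x y, [/\ g x = i, g y = j & le x y].
pose r i j : bool := if excluded_middle_informative (rel_le i j) then true else false.
have rP i j : r i j <-> rel_le i j.
  by rewrite /r; case: excluded_middle_informative.
have r_trans i j k : r i j -> r j k -> r i k.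
  move=> /rP [x [y [ex ey hxy]]] /rP [y' [w [ey' ew hyw]]]; apply/rP.
  by exists x, w; split=> //; have e : y = y' by [apply: ginj; rewrite ey]; subst y'; apply: le_trans hyw.
have r_refl i j : r i j -> r i i.
  by move=> /rP [x [y [ex _ _]]]; apply/rP; exists x, x.
have r_le x y : r (g x) (g y) <-> le x y.
  split=> [/rP [x' [y' [/ginj -> /ginj -> //]]]|hxy].
  by apply/rP; exists x, y.
exists (fun x => code_path Y (P1 ++ F) r (g x)); split.
  move=> x; split; first by rewrite /code_path -catA; apply: (@hom_infix [::]).
  have [pi hpi p0] := code_path_proj hY hR r (g x).
  apply/homP; exists (pi 0), (pi (size (code_path Y (P1 ++ F) r (g x)))).
  by split; [rewrite p0|apply/rd_walk; exists pi].
have rr x : r (g x) (g x) by apply/r_le.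
move=> x y; split=> [/r_le hxy|hom_xy].
  exact: (code_path_mono hY _ r_trans hxy (rr y)).
by apply/r_le; apply: (code_path_reflect hY hR hPR r_trans r_refl (rr x) hom_xy).
Qed.

(** * Height at most 3 *)

Lemma level_step h q G x y : walk (dirpath h) q G -> x <= size q -> y <= size q ->
  y = x.+1 \/ x = y.+1 -> step q (G x < G y) x y.
Proof.
move=> hG hx hy [e|e]; subst.
  by left; split=> //; split=> //; apply: (level_nth hG).
right; split=> //; split=> //; rewrite (level_nth hG) //.
by have := walk_unit hG hx; case; lia.
Qed.

(** For odd [d >= 3] its levels are 0, 1, 2, 1, 2, ..., 1, 2, 3; [zigzag 3] is the directed path. *)
Definition zigzag (d : nat) : opath := mkseq (fun j => [|| j == 0, j == d.-1 | odd j]) d.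

Lemma zigzag_hom q G d u v : walk (dirpath 3) q G -> u < v <= size q -> d = v - u ->
  (G u = 0 /\ G v = 3) \/ (G u = 3 /\ G v = 0) ->
  (forall t, u < t < v -> 0 < G t < 3) -> hom (zigzag d) q.
Proof.
move=> hG huv ed hends hin.
pose f j := if G u == 0 then u + j else v - j.
have fb j : j <= d -> u <= f j <= v by rewrite /f; case: ifP; lia.
have G0 : G (f 0) = 0.
  by rewrite /f; case: eqP => h; [rewrite addn0|rewrite subn0; case: hends; lia].
have Gd : G (f d) = 3.
  rewrite /f; case: eqP => h; [have -> : u + d = v by lia|have -> : v - d = u by lia];
  by case: hends; lia.
have uf : unit_steps d f by move=> j hj; rewrite /f; case: ifP; lia.
have uG : unit_steps d (G \o f).
  move=> j hj /=; have h1 := fb j (ltnW hj); have h2 := fb _ hj.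
  case: (uf j hj) => e; rewrite e in h2 *.
    by apply: (walk_unit hG); lia.
  by have := walk_unit hG (i := f j.+1) ltac:(lia); rewrite -e; case; auto.
have Gm j : 0 < j < d -> G (f j) = if odd j then 1 else 2.
  move=> hj; have [_ [_]] := @unit_lip _ _ 0 j uG isT ltac:(lia); rewrite /= G0.
  have := hin (f j); have : u < f j < v by rewrite /f; case: ifP; lia.
  by move=> h1 /(_ h1); case: ifP; lia.
have od : odd d.
  by have [_ [_]] := @unit_lip _ _ 0 d uG isT (leqnn _); rewrite /= G0 Gd; lia.
have d3 : 3 <= d.
  by have [h _] := @unit_lip _ _ 0 d uG isT (leqnn _); rewrite /= G0 Gd in h; lia.
apply/homP; exists (f 0), (f d); split; first by have := fb 0 isT; lia.
apply/rd_walk; exists f; rewrite /zigzag ?size_mkseq // => j; rewrite size_mkseq => hj.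
rewrite nth_mkseq //.
have -> : [|| j == 0, j == d.-1 | odd j] = (G (f j) < G (f j.+1)).
  have [e|h0] := eqVneq j 0.
    by subst j; rewrite G0 Gm /=; lia.
  have [e|h1] := eqVneq j d.-1.
    have e2 : j.+1 = d by lia.
    by rewrite e2 Gd Gm; [case: ifP|lia].
  rewrite /= !Gm; [|lia|lia]; rewrite /=; by case: (odd j).
have h1 := fb j (ltnW hj); have h2 := fb _ hj.
by apply: (level_step hG); [lia|lia|apply: uf].
Qed.

(* A vertex is sent according to its distance to the nearest vertex of level 0. *)
Lemma hom_zigzag p G d : walk (dirpath 3) p G -> (forall i, i <= size p -> G i <= 3) ->
  (exists2 i, i <= size p & G i = 0) -> odd d -> 3 <= d ->
  (forall i j, i <= size p -> j <= size p -> G i = 0 -> G j = 3 -> d <= dist i j) ->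
  hom p (zigzag d).
Proof.
move=> hG hb [i0 hi0 e0] od d3 hd.
have hex v : exists D, (exists i, [/\ i <= size p, G i = 0 & dist v i = D]) /\
    forall i, i <= size p -> G i = 0 -> D <= dist v i.
  have [|D h1 h2] := @nat_min (fun D => exists i, [/\ i <= size p, G i = 0 & dist v i = D]).
    by exists (dist v i0), i0.
  by exists D; split=> // i hi ei; apply: h2; exists i.
pose D v := proj1_sig (constructive_indefinite_description _ (hex v)).
have D1 v : exists i, [/\ i <= size p, G i = 0 & dist v i = D v].
  by case: (proj2_sig (constructive_indefinite_description _ (hex v))).
have D2 v i : i <= size p -> G i = 0 -> D v <= dist v i.
  by case: (proj2_sig (constructive_indefinite_description _ (hex v))) => _; apply.
have uG := walk_unit hG.
have Dpar v : v <= size p -> odd (D v) = odd (G v).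
  move=> hv; have [i [hi ei <-]] := D1 v; have [h|h] := leqP v i.
    by have [_ [_]] := unit_lip uG h hi; rewrite ei /dist; clear -h; lia.
  by have [_ [_]] := unit_lip uG (ltnW h) hv; rewrite ei /dist; clear -h; lia.
have D0 v : v <= size p -> G v = 0 -> D v = 0.
  by move=> hv ev; have := D2 v v hv ev; rewrite /dist; lia.
have Dpos v : G v <> 0 -> 0 < D v.
  move=> ev; have [i [hi ei e]] := D1 v; rewrite lt0n; apply/eqP => e'.
  by apply: ev; have -> : v = i by [rewrite /dist in e; lia].
have Dlip v v' : v' = v.+1 \/ v = v'.+1 -> D v <= (D v').+1.
  move=> hv; have [i [hi ei e]] := D1 v'; have := D2 v i hi ei.
  by rewrite -e /dist; clear -hv; lia.
have D3 v : v <= size p -> G v = 3 -> d <= D v.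
  move=> hv ev; have [i [hi ei <-]] := D1 v; have := hd i v hi hv ei ev.
  by rewrite /dist; lia.
(* The caps [d - 2] and [d - 1] are the last vertices of levels 1 and 2 in the zigzag. A vertex next
   to level 3 has distance at least [d - 1] from level 0, so it lands on the neighbour of the
   top. *)
pose pos v := match G v with 0 => 0 | 1 => minn (D v) d.-2 | 2 => minn (D v) d.-1 | _ => d end.
have hz j : j < d -> nth false (zigzag d) j = [|| j == 0, j == d.-1 | odd j].
  by move=> hj; rewrite /zigzag nth_mkseq.
have up v v' : v <= size p -> v' <= size p -> v' = v.+1 \/ v = v'.+1 -> G v' = (G v).+1 ->
    step (zigzag d) true (pos v) (pos v').
  move=> hv hv' hvv ev.
  have l1 := Dlip _ _ hvv; have l2 : D v' <= (D v).+1 by apply: Dlip; case: hvv; auto.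
  have q1 := Dpar v hv; have q2 := Dpar v' hv'.
  have b' := hb v' hv'; rewrite /step {1 3}/zigzag !size_mkseq /pos.
  case: (G v) (D0 v hv) (Dpos v) (D3 v hv) ev q1 => [|[|[|g]]] k0 kp k3 ev q1; last by lia.
  - have e1 := k0 erefl; rewrite ev; have e2 := Dpos v'; rewrite ev in e2.
    have e3 : D v' = 1 by have := e2 ltac:(lia); clear -e1 l2; lia.
    by left; rewrite e3; split; [|split; [lia|rewrite hz]]; lia.
  - have kv' := Dpos v'; rewrite ev in kv' q2 *; have {}kv' := kv' ltac:(lia).
    have {}kp := kp ltac:(lia); rewrite /= in q1 q2.
    clear -kp kv' q1 q2 l1 l2 hz od d3.
    have [h1|h1] := leqP (D v) d.-2; last first.
      left; split; [lia|split; [lia|]].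
      by rewrite hz; lia.
    have -> : minn (D v') d.-1 = D v' by lia.
    have [e|e] : D v' = (D v).+1 \/ D v = (D v').+1 by lia.
      by left; split; [|split; [|rewrite hz]]; lia.
    by right; split; [|split; [|rewrite hz]]; lia.
  - rewrite ev; have h := D3 v' hv' ev; left; clear -l2 h hz d3.
    have -> : minn (D v) d.-1 = d.-1 by lia.
    by split; [lia|split; [lia|rewrite hz; lia]].
apply/homP; exists (pos 0), (pos (size p)); split.
  by rewrite /zigzag size_mkseq /pos; case: (G 0) => [|[|[|g]]]; lia.
apply/rd_walk; exists pos => // i hi; have := uG i hi; rewrite (level_nth hG) //.
case=> e.
  by rewrite (_ : (G i < G i.+1)); [apply: up; auto; lia|lia].
rewrite (_ : (G i < G i.+1) = ~~ true); last by lia.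
by apply: step_sym; apply: up; auto; lia.
Qed.

(** A path without straight vertices folds onto a single arc, here the first one of [q]. *)
Lemma alternating_hom p q : 0 < size q -> (forall x, ~~ straight p x) -> hom p q.
Proof.
move=> hq hp; set b := nth false q 0.
have alt_p i : i < size p -> nth false p i = nth false p 0 (+) odd i.
  elim: i => [|i IH] hi; first by rewrite addbF.
  have := hp i.+1; rewrite /straight hi /= IH; last by exact: ltnW.
  by case: (nth _ _ i.+1); case: (nth _ _ 0); case: (odd i).
apply/homP; exists ((nth false p 0 != b) (+) odd 0 : nat), ((nth false p 0 != b) (+) odd (size p) : nat).
split; first by case: (_ (+) _).
apply/rd_walk; exists (fun i => (nth false p 0 != b) (+) odd i : nat) => // i hi.
rewrite alt_p // /step -/b /=.
by case: (nth _ p 0); case: (odd i); case eb : (b) => /=; auto.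
Qed.

Lemma straight_hom q x : straight q x -> hom (dirpath 2) q.
Proof.
case/and3P=> x0 xn /eqP ex; apply/homP; case e : (nth false q x).
  exists x.-1, x.+1; split; first by lia.
  exists x; first by left; rewrite ex e; split; [lia|split=> //; lia].
  by exists x.+1 => //; left.
exists x.+1, x.-1; split; first by lia.
exists x; first by right.
by exists x.-1 => //; right; rewrite ex e; split; [lia|split=> //; lia].
Qed.

Lemma dirpath_hom j k : j <= k -> hom (dirpath j) (dirpath k).
Proof.
move=> hjk; rewrite (_ : dirpath k = dirpath j ++ dirpath (k - j)); first exact: (@hom_infix [::]).
by rewrite /dirpath cat_nseq /ncons -iterD subnKC.
Qed.

Lemma level3_cases p : hom p (dirpath 3) -> hom p (dirpath 2) \/
  exists G, [/\ walk (dirpath 3) p G, forall i, i <= size p -> G i <= 3,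
    exists2 i, i <= size p & G i = 0 & exists2 i, i <= size p & G i = 3].
Proof.
move=> hp; have [h2|h2] := classic (hom p (dirpath 2)); [by left|right].
apply: height_level; split=> // j hj; rewrite leqNgt; apply/negP => hlt; apply: h2.
by apply: hom_trans hj _; apply: dirpath_hom.
Qed.

(** Below height 3 the chain consists of a vertex, an arc and the directed path with two arcs, and
    each of these maps to every path of the later kinds. *)
Lemma height3_comparable p q : hom p (dirpath 3) -> hom q (dirpath 3) -> hom p q \/ hom q p.
Proof.
move=> hp hq.
have [sp|sp] := posnP (size p).
  by left; exists id; split=> [v|u v]; rewrite /vertex /Defs.arc sp; [lia|case=> -[_ []]].
have [sq|sq] := posnP (size q).
  by right; exists id; split=> [v|u v]; rewrite /vertex /Defs.arc sq; [lia|case=> -[_ []]].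
have [[x hx]|nx] := classic (exists x, straight p x); last first.
  by left; apply: alternating_hom => // x; apply/negP => h; apply: nx; exists x.
have [[y hy]|ny] := classic (exists y, straight q y); last first.
  by right; apply: alternating_hom => // y; apply/negP => h; apply: ny; exists y.
have [hp2|[G [hG Gb G0 G3]]] := level3_cases hp.
  by left; apply: hom_trans hp2 (straight_hom hy).
have [hq2|[K [hK Kb K0 K3]]] := level3_cases hq.
  by right; apply: hom_trans hq2 (straight_hom hx).
have [u [v [huv ends inn mn]]] := closest_pair (walk_unit hG) (a := 0) (b := 3) isT G0 G3.
have [u' [v' [huv' ends' inn' mn']]] := closest_pair (walk_unit hK) (a := 0) (b := 3) isT K0 K3.
have par s H a c : walk (dirpath 3) s H -> a < c <= size s -> (H a = 0 /\ H c = 3) \/ (H a = 3 /\ H c = 0) ->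
    odd (c - a) /\ 3 <= c - a.
  move=> hH /andP [hac hc] he; have [h1 [h2 h3]] := unit_lip (walk_unit hH) (ltnW hac) hc.
  by clear -h1 h2 h3 he; lia.
have [o1 o2] := par _ _ _ _ hG huv ends; have [o1' o2'] := par _ _ _ _ hK huv' ends'.
(* [hom_zigzag] asks only for distance at least [d], so the path with the larger distance maps
   directly to the zigzag inside the other path. *)
have [hle|hlt] := leqP (v' - u') (v - u); [left|right].
  apply: (@hom_trans _ (zigzag (v' - u'))); last exact: (zigzag_hom hK huv').
  by apply: (hom_zigzag hG) => // i j hi hj ei ej; apply: leq_trans hle (mn _ _ _ _ _ _).
apply: (@hom_trans _ (zigzag (v - u))); last exact: (zigzag_hom hG huv).
by apply: (hom_zigzag hK) => // i j hi hj ei ej; apply: leq_trans (ltnW hlt) (mn' _ _ _ _ _ _).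
Qed.

Theorem theorem2 (P1 P2 : opath) :
  hom_lt P1 P2 ->
  (forall h, is_height P2 h -> 4 <= h -> interval_universal P1 P2) /\
  (forall h, is_height P2 h -> h <= 3 -> interval_chain P1 P2).
Proof.
case=> h12 h21; split=> h [hh hmin] hle.
  have [P [h2P hP2 hrig]] := core_exists P2.
  have hP : is_height P h.
    by split=> [|j hj]; [apply: hom_trans h2P hh|apply: hmin; apply: hom_trans hP2 hj].
  have hno : ~ hom P P1 by move=> hPP; apply: h21; apply: hom_trans hP2 hPP.
  move=> T le hT hle'.
  have [f [hf1 hf2]] := universal_above hrig hP hle (hom_trans h12 hP2) hno hT hle'.
  exists f; split=> // x; have [? hx] := hf1 x.
  by split=> //; apply: hom_trans hx h2P.
have h3 p : hom p P2 -> hom p (dirpath 3).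
  by move=> hp; apply: hom_trans hp (hom_trans hh (dirpath_hom hle)).
by move=> p q [_ /h3 hp] [_ /h3 hq]; apply: height3_comparable.
Qed.
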